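(* For the index triples $(i,j,k)$ appearing below put $$P_{ijk}=\rho_{jk}\,e^{\frac1\hbar p_i(u_k-u_j)}\,e^{\frac{\lambda_{jk}}{\hbar}(u_k-u_i)}\in N(A_3)\rtimes\mathfrak S_6,\qquad \mathcal R_{ijk}=\mathcal R(\lambda_i,\lambda_j,\lambda_k)_{ijk}=\Psi_q\big(e^{p_i+u_i+p_k-u_k-p_j+\lambda_{ik}}\big)\,P_{ijk}.$$ (1) The operator $P_{ijk}$ satisfies the tetrahedron equation in $N(A_3)\rtimes\mathfrak S_6$: $$P_{456}P_{236}P_{135}P_{124}=P_{124}P_{135}P_{236}P_{456}.$$ (2) The operator $\mathcal R_{ijk}$ satisfies the tetrahedron equation in $\hat{\mathcal W}_{\mathbb A}^{\times}\rtimes G$: $$\mathcal R(\lambda_4,\lambda_5,\lambda_6)_{456}\,\mathcal R(\lambda_2,\lambda_3,\lambda_6)_{236}\,\mathcal R(\lambda_1,\lambda_3,\lambda_5)_{135}\,\mathcal R(\lambda_1,\lambda_2,\lambda_4)_{124}$$ $$=\mathcal R(\lambda_1,\lambda_2,\lambda_4)_{124}\,\mathcal R(\lambda_1,\lambda_3,\lambda_5)_{135}\,\mathcal R(\lambda_2,\lambda_3,\lambda_6)_{236}\,\mathcal R(\lambda_4,\lambda_5,\lambda_6)_{456}.$$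
   Context: $q=e^{\hbar}$. $\lambda_1,\dots,\lambda_6$ are complex parameters, $\kappa_i=e^{\lambda_i}$, $\lambda_{jk}=\lambda_j-\lambda_k$. The noncommuting variables $p_i,u_i$ ($1\le i\le 6$) satisfy $[p_i,u_j]=\hbar\delta_{ij}$, $[p_i,p_j]=[u_i,u_j]=0$. $\mathcal W(A_3)$ is the $\mathbb C$-algebra generated by $e^{\pm p_i},e^{\pm u_i}$, with $e^{p_i}e^{u_j}=q^{\delta_{ij}}e^{u_j}e^{p_i}$, and $\mathrm{Frac}\,\mathcal W(A_3)$ is its noncommuting fractional field. Exponentials of linear combinations of the $p_i,u_i$ and constants are multiplied by the Baker–Campbell–Hausdorff (BCH) formula. $N(A_3)$ is the group generated by $e^{\pm\frac1\hbar p_iu_j}$ ($i\ne j$), $e^{\pm\frac a\hbar u_i}$ ($a\in\mathbb C$) and $b\in\mathbb C^\times$ ($i,j\in\{1,\dots,6\}$), with multiplication defined by the (generalized) BCH formula. $\mathfrak S_6$, generated by the transpositions $\rho_{ij}$, acts by permuting the indices of the $p_i,u_i$ (not of the parameters $\lambda_i,\kappa_i$), and $N(A_3)\rtimes\mathfrak S_6$ acts on $\mathcal W(A_3)$ by the adjoint action $\mathrm{Ad}(w)(x)=wxw^{-1}$. Quantum dilogarithm: $\Psi_q(U)=\dfrac1{(-qU;q^2)_\infty}=\sum_{n\ge0}\dfrac{(-qU)^n}{(q^2;q^2)_n}$, with $(z;q)_\infty=\prod_{k\ge0}(1-zq^k)$, $(z;q)_n=(z;q)_\infty/(zq^n;q)_\infty$.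 The Fock–Goncharov quiver $J_{123121}$ has vertices $1,\dots,9$ (all of weight one), ordinary arrows $1\to2$, $3\to4\to5$, $6\to7\to8\to9$, $5\to8\to4\to7\to3$, $2\to4\to1$, and dashed arrows (counted as half-arrows) $9\dashrightarrow5\dashrightarrow2$, $1\dashrightarrow3\dashrightarrow6$. Let $b_{ij}$ be the number of arrows from $i$ to $j$ minus the number from $j$ to $i$, a dashed arrow counting $\tfrac12$. $\mathcal Y$ is the skew field generated by $Y_1,\dots,Y_9$ with $Y_iY_j=q^{2b_{ij}}Y_jY_i$. $\mathbb A$ is the algebra generated over $\mathbb Q(q)$ by the monomials in the $Y_i$ with nonnegative exponents, $\hat{\mathbb A}$ is its completion with respect to the ideal generated by the $Y_i$, and $\hat{\mathbb A}^{\times}\subset\hat{\mathbb A}$ is the subset generated by all invertible elements of $\hat{\mathbb A}$. The embedding $\phi:\mathcal Y\hookrightarrow\mathrm{Frac}\,\mathcal W(A_3)$ is $Y_1\mapsto\kappa_3^{-1}e^{p_3-u_3-p_2}$, $Y_2\mapsto\kappa_3e^{p_3+u_3-p_5}$, $Y_3\mapsto\kappa_2^{-1}e^{p_2-u_2-p_1}$, $Y_4\mapsto\kappa_2\kappa_5^{-1}e^{p_2+u_2+p_5-u_5-p_3-p_4}$, $Y_5\mapsto\kappa_5e^{p_5+u_5-p_6}$, $Y_6\mapsto\kappa_1^{-1}e^{p_1-u_1}$, $Y_7\mapsto\kappa_1\kappa_4^{-1}e^{p_1+u_1+p_4-u_4-p_2}$, $Y_8\mapsto\kappa_4\kappa_6^{-1}e^{p_4+u_4+p_6-u_6-p_5}$,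 $Y_9\mapsto\kappa_6e^{p_6+u_6}$. $\mathcal W_{\mathbb A}=\phi(\mathbb A)\subset\mathcal W(A_3)$; $\hat{\mathcal W}_{\mathbb A}$ is its completion with respect to the ideal generated by the $\phi(Y_i)$; $\phi$ induces a map $\hat{\mathbb A}\to\hat{\mathcal W}_{\mathbb A}$, also denoted $\phi$, and $\hat{\mathcal W}_{\mathbb A}^\times=\phi(\hat{\mathbb A}^\times)$. Finally $$G=\{w\in N(A_3)\rtimes\mathfrak S_6:\ \mathrm{Ad}(w)(\phi(\mathcal Y))\subset\phi(\mathcal Y)\},$$ which acts on $\hat{\mathcal W}_{\mathbb A}$ by the adjoint action, restricting to actions on $\mathcal W_{\mathbb A}$ and on $\hat{\mathcal W}_{\mathbb A}^\times$; this gives the semidirect product $\hat{\mathcal W}_{\mathbb A}^{\times}\rtimes G$.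
   Formalization: P_456 is not in G as defined (Ad(P_456)φ(Y_5) is not in φ(Y)), so (2) is stated with N(A_3)⋊S_6 in place of G, and it is proved that each dilogarithm factor, once the P's are moved to the right, and each product lies in Ŵ_A^×; q is not a root of unity. *)

(* Defs.v *)
From HB Require Import structures.
From mathcomp Require Import all_boot all_order all_algebra fingroup perm.
From mathcomp Require Import complex.
From mathcomp Require Import boolp classical_sets functions fsbigop reals.
From mathcomp Require Import sequences exp trigo.

Set Implicit Arguments.
Unset Strict Implicit.
Unset Printing Implicit Defensive.
Import Order.TTheory GRing.Theory Num.Theory.

Local Open Scope classical_set_scope.
Local Open Scope ring_scope.

(* The indices 1, .., 6 of p_i, u_i, lambda_i and 1, .., 9 of Y_i are shifted
   to 0, .., 5 in 'I_6 and 0, .., 8 in 'I_9. *)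
Definition ix (n : nat) : 'I_6 := inord n.-1.

Definition Cexp (R : realType) (z : R[i]) : R[i] :=
  Complex (expR (complex.Re z) * cos (complex.Im z))
          (expR (complex.Re z) * sin (complex.Im z)).

(* ((a, b), c) stands for  sum_i a_i p_i + sum_i b_i u_i + c. *)
Definition expo : Type := ('rV[int]_6 * 'rV[int]_6)%type.
HB.instance Definition _ := GRing.Zmodule.on expo.

Definition linform (R : realType) : Type := (expo * R[i])%type.
HB.instance Definition _ (R : realType) := GRing.Zmodule.on (linform R).

Definition pv (R : realType) (i : 'I_6) : linform R := ((delta_mx 0 i, 0), 0).
Definition uv (R : realType) (i : 'I_6) : linform R := ((0, delta_mx 0 i), 0).
Definition cst (R : realType) (c : R[i]) : linform R := (0, c).

(* GPU i j s : the exponent  (-1)^s p_i u_j / hbar;  GU i a : a u_i / hbar. *)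
Inductive ngen (R : realType) : Type :=
| GPU (i j : 'I_6) of i != j & bool
| GU of 'I_6 & R[i].

(* The pair (M, a) stands for  (sum_ij M_ij p_i u_j + sum_i a_i u_i) / hbar. *)
Definition liealg (R : realType) : Type := ('M[int]_6 * 'rV[R[i]]_6)%type.
HB.instance Definition _ (R : realType) := GRing.Zmodule.on (liealg R).

Definition log (R : realType) (x : ngen R) : liealg R :=
  match x with
  | GPU i j _ s => ((-1) ^+ s *: delta_mx i j, 0)
  | GU i a => (0, a *: delta_mx 0 i)
  end.

Definition mxC (R : realType) m n (M : 'M[int]_(m, n)) : 'M[R[i]]_(m, n) :=
  map_mx intr M.

(* The commutator XY - YX computed from [p_i, u_j] = hbar delta_ij:
   [p_i u_j, p_k u_l] = hbar (delta_il p_k u_j - delta_jk p_i u_l),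
   [p_i u_j, u_k] = hbar delta_ik u_j. *)
Definition bracket (R : realType) (X Y : liealg R) : liealg R :=
  (Y.1 *m X.1 - X.1 *m Y.1, Y.2 *m mxC R X.1 - X.2 *m mxC R Y.1).

Inductive letter (R : realType) : Type :=
| EXP of ngen R
| CST (b : R[i]) of b != 0.

HB.instance Definition _ (R : realType) := gen_eqMixin (letter R).
HB.instance Definition _ (R : realType) := gen_choiceMixin (letter R).

Definition word (R : realType) : Type := seq (letter R).
HB.instance Definition _ (R : realType) := Choice.on (word R).

(* The congruence generated by the Baker-Campbell-Hausdorff formula
   e^X e^Y = e^(X + Y + [X, Y] / 2) for [X, Y] commuting with X and Y, which
   between the generators amounts to e^X e^Y = e^[X, Y] e^Y e^X together with
   e^X e^Y = e^(X + Y) when [X, Y] = 0. *)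
Inductive bch (R : realType) : word R -> word R -> Prop :=
| bch_refl w : bch w w
| bch_sym w w' : bch w w' -> bch w' w
| bch_trans w w' w'' : bch w w' -> bch w' w'' -> bch w w''
| bch_cat w1 w1' w2 w2' :
    bch w1 w1' -> bch w2 w2' -> bch (w1 ++ w2) (w1' ++ w2')
| bch_comm x y z :
    bracket (log x) (log y) = log z ->
    bracket (log x) (log z) = 0 -> bracket (log y) (log z) = 0 ->
    bch [:: EXP x; EXP y] [:: EXP z; EXP y; EXP x]
| bch_comm0 x y :
    bracket (log x) (log y) = 0 -> bch [:: EXP x; EXP y] [:: EXP y; EXP x]
| bch_add x y z :
    bracket (log x) (log y) = 0 -> log x + log y = log z ->
    bch [:: EXP x; EXP y] [:: EXP z]
| bch_exp0 x : log x = 0 -> bch [:: EXP x] [::]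
| bch_cstC b (hb : b != 0) x :
    bch [:: CST hb; EXP x] [:: EXP x; CST hb]
| bch_cstM b c (hb : b != 0) (hc : c != 0) (hbc : b * c != 0) :
    bch [:: CST hb; CST hc] [:: CST hbc]
| bch_cst1 (h1 : 1 != 0 :> R[i]) : bch [:: CST h1] [::].

Definition bchb (R : realType) (w w' : word R) : bool := `[< bch w w' >].

Lemma bchb_refl (R : realType) : reflexive (@bchb R).
Proof. by move=> w; apply/asboolP; apply: bch_refl. Qed.

Lemma bchb_sym (R : realType) : symmetric (@bchb R).
Proof. by move=> w w'; apply: asbool_equiv_eq; split; apply: bch_sym. Qed.

Lemma bchb_trans (R : realType) : transitive (@bchb R).
Proof.
move=> w' w w'' /asboolP h /asboolP h'; apply/asboolP.
exact: bch_trans h h'.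
Qed.

Canonical bch_equiv (R : realType) :=
  EquivRel (@bchb R) (@bchb_refl R) (@bchb_sym R) (@bchb_trans R).

Local Open Scope quotient_scope.

Definition NA3 (R : realType) : Type := {eq_quot (bch_equiv R)}.
HB.instance Definition _ (R : realType) := Choice.on (NA3 R).
HB.instance Definition _ (R : realType) := EqQuotient.on (NA3 R).

Lemma NA3_eqP (R : realType) (w w' : word R) :
  bch w w' <-> \pi_(NA3 R) w = \pi_(NA3 R) w'.
Proof.
by split=> [h|/eqmodP/asboolP //]; apply/eqmodP/asboolP.
Qed.

Lemma NA3_repr (R : realType) (w : word R) :
  bch (generic_quotient.repr (\pi_(NA3 R) w)) w.
Proof. by apply/NA3_eqP; rewrite generic_quotient.reprK. Qed.

Definition inv_letter (R : realType) (l : letter R) : letter R :=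
  match l with
  | EXP (GPU _ _ h s) => EXP (GPU R h (~~ s))
  | EXP (GU i a) => EXP (GU i (- a))
  | CST _ hb => CST (invr_neq0 hb)
  end.

Definition inv_word (R : realType) (w : word R) : word R :=
  rev (map (@inv_letter R) w).

Lemma bracketxx (R : realType) (X : liealg R) : bracket X X = 0.
Proof. by rewrite /bracket !subrr. Qed.

Lemma bracketxN (R : realType) (X : liealg R) : bracket X (- X) = 0.
Proof.
rewrite /bracket /= /mxC map_mxN.
by rewrite !mulNmx !mulmxN !subrr.
Qed.

Lemma bch_exp_inv (R : realType) (x y : ngen R) :
  log y = - log x -> bch [:: EXP x; EXP y] [::].
Proof.
move=> hy; apply: (@bch_trans _ _ [:: EXP (GU ord0 0)]).
  apply: bch_add; first by rewrite hy bracketxN.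
  by rewrite hy subrr /= scale0r.
by apply: bch_exp0; rewrite /= scale0r.
Qed.

Lemma bch_mulV (R : realType) (l : letter R) :
  bch [:: l; inv_letter l] [::] /\ bch [:: inv_letter l; l] [::].
Proof.
case: l => [[i j h s|i a]|b hb] /=.
- have e t : log (GPU R h (~~ t)) = - log (GPU R h t).
    rewrite /log; congr pair; rewrite ?oppr0 // -scaleNr.
    by case: t; rewrite ?expr0 ?expr1 ?opprK.
  by split; apply: bch_exp_inv; rewrite ?e ?opprK.
- have e c : log (GU i (- c)) = - log (GU i c).
    by rewrite /log; congr pair; rewrite ?oppr0 // scaleNr.
  by split; apply: bch_exp_inv; rewrite ?e ?opprK.
- have e1 : b * b^-1 != 0 by rewrite divff // oner_neq0.
  have e2 : b^-1 * b != 0 by rewrite mulVf // oner_neq0.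
  have aux c (hc : c != 0) : c = 1 -> bch [:: CST hc] [::].
    by move=> c1; move: hc; rewrite c1 => hc; apply: bch_cst1.
  by split; (apply: bch_trans; first exact: bch_cstM); apply: aux;
    rewrite ?divff ?mulVf.
Qed.

Lemma bch_wordV (R : realType) (w : word R) : bch (w ++ inv_word w) [::].
Proof.
elim: w => [|l w IH]; first exact: (bch_refl [::]).
have -> : (l :: w) ++ inv_word (l :: w) =
    [:: l] ++ ((w ++ inv_word w) ++ [:: inv_letter l]).
  by rewrite /inv_word /= rev_cons -cats1 catA.
apply: (@bch_trans _ _ ([:: l] ++ ([::] ++ [:: inv_letter l]))).
  apply: bch_cat; first exact: bch_refl.
  by apply: bch_cat; [exact: IH | apply: bch_refl].
by have [] := bch_mulV l.
Qed.

Lemma bch_Vword (R : realType) (w : word R) : bch (inv_word w ++ w) [::].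
Proof.
elim: w => [|l w IH]; first exact: (bch_refl [::]).
have -> : inv_word (l :: w) ++ l :: w =
    inv_word w ++ ([:: inv_letter l; l] ++ w).
  by rewrite /inv_word /= rev_cons -cats1 -catA.
apply: (bch_trans _ IH); apply: bch_cat; first exact: bch_refl.
apply: (@bch_cat _ _ [::] w w); last exact: bch_refl.
by have [] := bch_mulV l.
Qed.

Definition mulN (R : realType) (x y : NA3 R) : NA3 R :=
  \pi_(NA3 R) (generic_quotient.repr x ++ generic_quotient.repr y).
Definition oneN (R : realType) : NA3 R := \pi_(NA3 R) [::].
Definition invN (R : realType) (x : NA3 R) : NA3 R :=
  \pi_(NA3 R) (inv_word (generic_quotient.repr x)).

Lemma mulN_pi (R : realType) (w w' : word R) :
  mulN (\pi_(NA3 R) w) (\pi_(NA3 R) w') = \pi_(NA3 R) (w ++ w').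
Proof. by apply/NA3_eqP; apply: bch_cat; apply: NA3_repr. Qed.

Lemma NA3_ex (R : realType) (x : NA3 R) : exists w, x = \pi_(NA3 R) w.
Proof. by exists (generic_quotient.repr x); rewrite generic_quotient.reprK. Qed.

Lemma invN_pi (R : realType) (w : word R) :
  invN (\pi_(NA3 R) w) = \pi_(NA3 R) (inv_word w).
Proof.
rewrite /invN; set v := generic_quotient.repr _.
have hv : bch v w by apply: NA3_repr.
apply/NA3_eqP; apply: (@bch_trans _ _ (inv_word v ++ (w ++ inv_word w))).
  rewrite -[X in bch X _]cats0; apply: bch_cat; first exact: bch_refl.
  by apply: bch_sym; apply: bch_wordV.
rewrite catA -[X in bch _ X]cat0s; apply: bch_cat; last exact: bch_refl.
apply: bch_trans (bch_Vword v); apply: bch_cat; first exact: bch_refl.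
exact: bch_sym.
Qed.

Lemma mulNA (R : realType) : associative (@mulN R).
Proof.
move=> x y z; have [a ->] := NA3_ex x; have [b ->] := NA3_ex y.
by have [c ->] := NA3_ex z; rewrite !mulN_pi catA.
Qed.

Lemma mul1N (R : realType) : left_id (oneN R) (@mulN R).
Proof. by move=> x; have [a ->] := NA3_ex x; rewrite mulN_pi. Qed.

Lemma mulN1 (R : realType) : right_id (oneN R) (@mulN R).
Proof. by move=> x; have [a ->] := NA3_ex x; rewrite mulN_pi cats0. Qed.

Lemma mulVN (R : realType) : left_inverse (oneN R) (@invN R) (@mulN R).
Proof.
move=> x; have [a ->] := NA3_ex x; rewrite invN_pi mulN_pi.
by apply/NA3_eqP; apply: bch_Vword.
Qed.

Lemma mulNV (R : realType) : right_inverse (oneN R) (@invN R) (@mulN R).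
Proof.
move=> x; have [a ->] := NA3_ex x; rewrite invN_pi mulN_pi.
by apply/NA3_eqP; apply: bch_wordV.
Qed.

HB.instance Definition _ (R : realType) := isGroup.Build (NA3 R)
  (@mulNA R) (@mul1N R) (@mulN1 R) (@mulVN R) (@mulNV R).

Definition perm_ngen (R : realType) (s : 'S_6) (x : ngen R) : ngen R :=
  match x with
  | GPU i j h t => GPU R (etrans (congr1 negb (inj_eq (@perm_inj _ s) i j)) h) t
  | GU i a => GU (s i) a
  end.

Definition perm_letter (R : realType) (s : 'S_6) (l : letter R) : letter R :=
  match l with
  | EXP x => EXP (perm_ngen s x)
  | CST _ hb => CST hb
  end.

Definition perm_word (R : realType) (s : 'S_6) : word R -> word R :=
  map (@perm_letter R s).

Definition perm_lie (R : realType) (s : 'S_6) (X : liealg R) : liealg R :=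
  (perm_mx s^-1%g *m X.1 *m perm_mx s, X.2 *m perm_mx s).

Lemma delta_permr (K : pzRingType) (s : 'S_6) (i : 'I_6) :
  delta_mx 0 i *m perm_mx s = delta_mx 0 (s i) :> 'rV[K]_6.
Proof.
by rewrite -rowE; apply/rowP => j; rewrite !mxE eqxx /= eq_sym.
Qed.

Lemma delta_perml (s : 'S_6) (i : 'I_6) :
  perm_mx s^-1%g *m delta_mx i 0 = delta_mx (s i) 0 :> 'cV[int]_6.
Proof.
by rewrite -colE; apply/colP => j; rewrite !mxE eqxx andbT -{2}[j](permKV s)
  (inj_eq perm_inj).
Qed.

Lemma log_perm (R : realType) (s : 'S_6) (x : ngen R) :
  log (perm_ngen s x) = perm_lie s (log x).
Proof.
case: x => [i j h t|i a]; rewrite /log /perm_lie /=; congr pair.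
- rewrite -scalemxAr -scalemxAl -(mul_delta_mx (0 : 'I_1) i j) mulmxA
    delta_perml.
  by rewrite -mulmxA delta_permr mul_delta_mx.
- by rewrite mul0mx.
- by rewrite mulmx0 mul0mx.
- by rewrite -scalemxAl delta_permr.
Qed.

Lemma bracket_perm (R : realType) (s : 'S_6) (X Y : liealg R) :
  bracket (perm_lie s X) (perm_lie s Y) = perm_lie s (bracket X Y).
Proof.
have hM (A B : 'M[int]_6) :
    perm_mx s^-1 *m A *m perm_mx s *m (perm_mx s^-1 *m B *m perm_mx s) =
    perm_mx s^-1 *m (A *m B) *m perm_mx s.
  by rewrite !mulmxA -[X in X *m B *m _ = _]mulmxA -perm_mxM mulgV perm_mx1
    mulmx1.
have ha (a : 'rV[R[i]]_6) (A : 'M[int]_6) :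
    a *m perm_mx s *m mxC R (perm_mx s^-1 *m A *m perm_mx s) =
    a *m mxC R A *m perm_mx s.
  rewrite /mxC !map_mxM !map_perm_mx !mulmxA.
  by rewrite -[X in X *m _ *m _ = _]mulmxA -perm_mxM mulgV perm_mx1 mulmx1.
rewrite /bracket /perm_lie /=; congr pair.
  by rewrite !hM mulmxBr mulmxBl.
by rewrite !ha mulmxBl.
Qed.

Lemma perm_lie0 (R : realType) (s : 'S_6) : perm_lie s 0 = 0 :> liealg R.
Proof. by rewrite /perm_lie /= mulmx0 !mul0mx. Qed.

Lemma perm_lieD (R : realType) (s : 'S_6) (X Y : liealg R) :
  perm_lie s (X + Y) = perm_lie s X + perm_lie s Y.
Proof. by rewrite /perm_lie /= mulmxDr !mulmxDl. Qed.

Lemma bch_perm (R : realType) (s : 'S_6) (w w' : word R) :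
  bch w w' -> bch (perm_word s w) (perm_word s w').
Proof.
elim=> {w w'} /=.
- by move=> w; apply: bch_refl.
- by move=> w w' _; apply: bch_sym.
- by move=> w w' w'' _ h _; apply: bch_trans.
- move=> w1 w1' w2 w2' _ h1 _ h2.
  by rewrite /perm_word !map_cat; apply: bch_cat.
- move=> x y z h1 h2 h3; apply: bch_comm; rewrite !log_perm bracket_perm.
  + by rewrite h1.
  + by rewrite h2 perm_lie0.
  + by rewrite h3 perm_lie0.
- move=> x y h; apply: bch_comm0.
  by rewrite !log_perm bracket_perm h perm_lie0.
- move=> x y z h1 h2; apply: bch_add; rewrite !log_perm.
  + by rewrite bracket_perm h1 perm_lie0.
  + by rewrite -perm_lieD h2.
- by move=> x h; apply: bch_exp0; rewrite log_perm h perm_lie0.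
- by move=> b hb x; apply: bch_cstC.
- by move=> b c hb hc hbc; apply: bch_cstM.
- by move=> h1; apply: bch_cst1.
Qed.

Lemma GPU_eq (R : realType) i j i' j' (h : i != j) (h' : i' != j') t :
  i = i' -> j = j' -> GPU R h t = GPU R h' t.
Proof.
move=> ei ej; move: h h'; rewrite ei ej => h h'.
by rewrite (bool_irrelevance h h').
Qed.

Lemma perm_wordM (R : realType) (s t : 'S_6) (w : word R) :
  perm_word (s * t)%g w = perm_word t (perm_word s w).
Proof.
rewrite /perm_word -map_comp; apply: eq_map; case=> [[i j h u|i a]|b hb] //=.
- by congr EXP; apply: GPU_eq; rewrite permM.
- by rewrite permM.
Qed.

Lemma perm_word1 (R : realType) (w : word R) : perm_word 1%g w = w.
Proof.
rewrite -[RHS]map_id; apply: eq_map; case=> [[i j h u|i a]|b hb] //=.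
- by congr EXP; apply: GPU_eq; rewrite perm1.
- by rewrite perm1.
Qed.

Definition permN (R : realType) (s : 'S_6) (x : NA3 R) : NA3 R :=
  \pi_(NA3 R) (perm_word s (generic_quotient.repr x)).

Lemma permN_pi (R : realType) (s : 'S_6) (w : word R) :
  permN s (\pi_(NA3 R) w) = \pi_(NA3 R) (perm_word s w).
Proof. by apply/NA3_eqP; apply: bch_perm; apply: NA3_repr. Qed.

Lemma permN_mul (R : realType) (s : 'S_6) (x y : NA3 R) :
  permN s (mulN x y) = mulN (permN s x) (permN s y).
Proof.
have [a ->] := NA3_ex x; have [b ->] := NA3_ex y.
by rewrite !(mulN_pi, permN_pi) /perm_word map_cat.
Qed.

Lemma permN_one (R : realType) (s : 'S_6) : permN s (oneN R) = oneN R.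
Proof. exact: permN_pi. Qed.

Lemma permN_M (R : realType) (s t : 'S_6) (x : NA3 R) :
  permN (s * t)%g x = permN t (permN s x).
Proof. by have [a ->] := NA3_ex x; rewrite !permN_pi perm_wordM. Qed.

Lemma permN_1 (R : realType) (x : NA3 R) : permN 1%g x = x.
Proof. by have [a ->] := NA3_ex x; rewrite permN_pi perm_word1. Qed.

(* (n, s) stands for the product n s, so that (n, s)(n', s') is
   (n (s n' s^-1), s o s').  In the library (s' * s)%g is the composite
   s o s', i.e. i |-> s (s' i). *)
Definition NS6 (R : realType) : Type := (NA3 R * 'S_6)%type.
HB.instance Definition _ (R : realType) := Choice.on (NS6 R).

Definition mulNS (R : realType) (x y : NS6 R) : NS6 R :=
  (mulN x.1 (permN x.2 y.1), (y.2 * x.2)%g).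
Definition oneNS (R : realType) : NS6 R := (oneN R, 1%g).
Definition invNS (R : realType) (x : NS6 R) : NS6 R :=
  (permN x.2^-1%g (invN x.1), x.2^-1%g).

Lemma mulNSA (R : realType) : associative (@mulNS R).
Proof.
move=> [a s] [b t] [c u]; rewrite /mulNS /=; congr pair.
  by rewrite permN_mul permN_M mulNA.
by rewrite mulgA.
Qed.

Lemma mul1NS (R : realType) : left_id (oneNS R) (@mulNS R).
Proof. by move=> [a s]; rewrite /mulNS /= permN_1 mul1N mulg1. Qed.

Lemma mulNS1 (R : realType) : right_id (oneNS R) (@mulNS R).
Proof. by move=> [a s]; rewrite /mulNS /= permN_one mulN1 mul1g. Qed.

Lemma mulVNS (R : realType) : left_inverse (oneNS R) (@invNS R) (@mulNS R).
Proof.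
move=> [a s]; rewrite /mulNS /invNS /oneNS /= -permN_mul mulVN permN_one.
by rewrite mulgV.
Qed.

Lemma mulNSV (R : realType) : right_inverse (oneNS R) (@invNS R) (@mulNS R).
Proof.
move=> [a s]; rewrite /mulNS /invNS /oneNS /= -permN_M mulVg permN_1 mulNV.
by [].
Qed.

HB.instance Definition _ (R : realType) := isGroup.Build (NS6 R)
  (@mulNSA R) (@mul1NS R) (@mulNS1 R) (@mulVNS R) (@mulNSV R).

(* e^X v e^(-X) = v + [X, v] for v a linear form in the p_i, u_i: the double
   commutator [X, [X, v]] vanishes for X = (M, a) the exponent of a generator,
   where M^2 = 0 and one of M, a is 0. *)
Definition ad_lie (R : realType) (X : liealg R) (v : linform R) : linform R :=
  ((v.1.1 - v.1.1 *m X.1^T, v.1.2 + v.1.2 *m X.1),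
   v.2 - (X.2 *m (mxC R v.1.1)^T) 0 0).

Definition ad_letter (R : realType) (l : letter R) (v : linform R) :
    linform R :=
  match l with
  | EXP x => ad_lie (log x) v
  | CST _ _ => v
  end.

Definition ad_word (R : realType) (w : word R) (v : linform R) : linform R :=
  foldr (@ad_letter R) v w.

Definition ad_perm (R : realType) (s : 'S_6) (v : linform R) : linform R :=
  ((v.1.1 *m perm_mx s, v.1.2 *m perm_mx s), v.2).

Definition Ad (R : realType) (g : NS6 R) (v : linform R) : linform R :=
  ad_word (generic_quotient.repr g.1) (ad_perm g.2 v).

Lemma log_sq (R : realType) (x : ngen R) : (log x).1 *m (log x).1 = 0.
Proof.
case: x => [i j h t|i a] /=; last by rewrite mulmx0.
rewrite -scalemxAr -scalemxAl mul_delta_mx_0 ?scaler0 //.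
by rewrite eq_sym.
Qed.

Lemma log_pure (R : realType) (x : ngen R) : (log x).1 = 0 \/ (log x).2 = 0.
Proof. by case: x => [i j h t|i a]; [right | left]. Qed.

Lemma mx_double0 (m n : nat) (A : 'M[int]_(m, n)) : A = - A -> A = 0.
Proof.
move=> h; apply/matrixP => i j; have := congr1 (fun B : 'M__ => B i j) h.
by rewrite !mxE => /eqP; rewrite -addr_eq0 -mulr2n mulrn_eq0 => /eqP.
Qed.

Lemma mxCM (R : realType) m n k (A : 'M[int]_(m, n)) (B : 'M[int]_(n, k)) :
  mxC R (A *m B) = mxC R A *m mxC R B.
Proof. exact: map_mxM. Qed.

Lemma mxC0 (R : realType) m n : mxC R (0 : 'M[int]_(m, n)) = 0.
Proof. exact: map_mx0. Qed.

Lemma mxC_shift (R : realType) (p : 'rV[int]_6) (N : 'M[int]_6) :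
  (mxC R (p - p *m N^T))^T = (mxC R p)^T - mxC R N *m (mxC R p)^T.
Proof.
rewrite /mxC map_mxB map_mxM linearB /= trmx_mul; congr (_ - _ *m _).
by rewrite -map_trmx trmxK.
Qed.

Lemma ad_lie_comp (R : realType) (X Y : liealg R) (v : linform R) :
  ad_lie X (ad_lie Y v) =
  ((v.1.1 - v.1.1 *m (X.1 + Y.1 - X.1 *m Y.1)^T,
    v.1.2 + v.1.2 *m (X.1 + Y.1 + Y.1 *m X.1)),
   v.2 - ((X.2 + Y.2 - X.2 *m mxC R Y.1) *m (mxC R v.1.1)^T) 0 0).
Proof.
case: X => M a; case: Y => N b; case: v => [[p u] c].
rewrite /ad_lie /=; congr ((_, _), _).
- have -> : (M + N - M *m N)^T = M^T + N^T - N^T *m M^T.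
    by rewrite linearB linearD /= trmx_mul.
  rewrite mulmxBr mulmxDr mulmxBl mulmxA.
  by rewrite !opprD !opprK !addrA [p - p *m N^T - _]addrAC.
- by rewrite !mulmxDr !mulmxDl mulmxA -!addrA; congr (_ + _); rewrite addrCA.
- rewrite mxC_shift mulmxBr !mulmxBl mulmxDl mulmxA.
  move: (a *m _) (b *m _) (_ *m _ *m _) => A B D.
  by rewrite !mxE !opprD !opprK !addrA [c - _ - _]addrAC.
Qed.

Lemma ad_exp_comm (R : realType) (x y z : ngen R) (v : linform R) :
  bracket (log x) (log y) = log z ->
  bracket (log x) (log z) = 0 -> bracket (log y) (log z) = 0 ->
  ad_lie (log x) (ad_lie (log y) v) =
  ad_lie (log z) (ad_lie (log y) (ad_lie (log x) v)).
Proof.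
have := log_sq x; have := log_sq y; have := log_pure x; have := log_pure y.
move: (log x) (log y) (log z) => [M a] [N b] [K k] /= pN pM N2 M2.
rewrite /bracket /= => -[hK hk] [hKM hkM] [hKN hkN].
have MK : M *m K = 0.
  apply: mx_double0; move/eqP: hKM; rewrite subr_eq0 => /eqP hKM.
  rewrite -[in RHS]hKM -{1}hK -[in RHS]hK mulmxBr mulmxBl !mulmxA M2 mul0mx.
  by rewrite subr0 -[N *m M *m M]mulmxA M2 mulmx0 sub0r opprK.
have NK : N *m K = 0.
  apply: mx_double0; move/eqP: hKN; rewrite subr_eq0 => /eqP hKN.
  rewrite -[in RHS]hKN -{1}hK -[in RHS]hK mulmxBr mulmxBl !mulmxA N2 mul0mx.
  by rewrite sub0r -[M *m N *m N]mulmxA N2 mulmx0 subr0.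
have kM : k *m mxC R M = 0.
  case: pM => [->|a0]; first by rewrite mxC0 mulmx0.
  by move: hkM; rewrite a0 mul0mx subr0.
have kN : k *m mxC R N = 0.
  case: pN => [->|b0]; first by rewrite mxC0 mulmx0.
  by move: hkN; rewrite b0 mul0mx subr0.
have KM : K *m M = 0 by move/eqP: hKM; rewrite MK subr0 => /eqP.
have KN : K *m N = 0 by move/eqP: hKN; rewrite NK subr0 => /eqP.
rewrite (ad_lie_comp (M, a) (N, b)) (ad_lie_comp (N, b) (M, a)) /ad_lie /=.
case: v => [[p u] c] /=.
set A := N + M - N *m M; set B := N + M + M *m N; set d := b + a - b *m mxC R M.
have eA : M + N - M *m N = A + K - K *m A.
  rewrite /A mulmxBr mulmxDr KN KM mulmxA KN mul0mx -hK addr0 subr0 subr0.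
  by rewrite [M + N]addrC -!addrA; congr (_ + (_ + _));
    rewrite addrA addNr add0r.
have eB : M + N + N *m M = B + K + B *m K.
  rewrite /B !mulmxDl -mulmxA NK MK mulmx0 !addr0 -hK.
  by rewrite [M + N]addrC -!addrA; congr (_ + (_ + _)); rewrite addrC subrK.
have ed : a + b - a *m mxC R N = d + k - k *m mxC R A.
  have -> : k *m mxC R A = 0.
    rewrite /A /mxC map_mxB map_mxD map_mxM -!/(mxC _ _) mulmxBr mulmxDr.
    by rewrite mulmxA kM kN mul0mx !addr0 subrr.
  rewrite /d subr0 -hk [a + b]addrC -!addrA; congr (_ + (_ + _)).
  by rewrite addrA addNr add0r.
clearbody A B d; congr ((_, _), _).
- have -> : (M + N - M *m N)^T = A^T + K^T - A^T *m K^T.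
    by rewrite eA linearB linearD /= trmx_mul.
  rewrite mulmxBr mulmxDr mulmxBl mulmxA.
  by rewrite !opprD !opprK !addrA.
- by rewrite eB !mulmxDr mulmxDl mulmxA !addrA.
- rewrite ed mxC_shift mulmxBr mulmxA mulmxBl mulmxDl.
  move: (d *m _) (k *m _) (_ *m _ *m _) => X Y Z.
  by rewrite !mxE !opprD !opprK !addrA.
Qed.

Lemma ad_exp_comm0 (R : realType) (x y : ngen R) (v : linform R) :
  bracket (log x) (log y) = 0 ->
  ad_lie (log x) (ad_lie (log y) v) = ad_lie (log y) (ad_lie (log x) v).
Proof.
rewrite /bracket => -[/eqP h1 /eqP h2]; move: h1 h2.
rewrite !subr_eq0 => /eqP h1 /eqP h2.
rewrite !ad_lie_comp; move: (log x) (log y) h1 h2 => [M a] [N b] /= h1 h2.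
have -> : M + N - M *m N = N + M - N *m M by rewrite h1 [M + N]addrC.
have -> : M + N + N *m M = N + M + M *m N by rewrite h1 [M + N]addrC.
by have -> : a + b - a *m mxC R N = b + a - b *m mxC R M
  by rewrite h2 [a + b]addrC.
Qed.

Lemma ad_exp_add (R : realType) (x y z : ngen R) (v : linform R) :
  bracket (log x) (log y) = 0 -> log x + log y = log z ->
  ad_lie (log x) (ad_lie (log y) v) = ad_lie (log z) v.
Proof.
move=> h hz; have := log_sq z; have := log_sq y; have := log_sq x.
have := log_pure z; have := log_pure x; rewrite -hz ad_lie_comp.
move: (log x) (log y) h => [M a] [N b]; rewrite /bracket /=.
move=> -[/eqP h1 /eqP h2]; move: h1 h2; rewrite !subr_eq0 => /eqP h1 /eqP h2.
move=> px pz M2 N2; rewrite mulmxDl !mulmxDr M2 N2 h1 add0r addr0 => MN.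
have {}MN : M *m N = 0 by apply: mx_double0; apply/eqP; rewrite -addr_eq0 MN.
have aN : a *m mxC R N = 0.
  case: px => [M0|->]; last by rewrite mul0mx.
  by rewrite -h2 M0 mxC0 mulmx0.
by rewrite MN aN !subr0 mulmx0 addr0 -mulmxDr.
Qed.

Lemma ad_word_cat (R : realType) (w w' : word R) (v : linform R) :
  ad_word (w ++ w') v = ad_word w (ad_word w' v).
Proof. exact: foldr_cat. Qed.

Lemma ad_bch (R : realType) (w w' : word R) (v : linform R) :
  bch w w' -> ad_word w v = ad_word w' v.
Proof.
move=> h; elim: h v => {w w'} /=.
- by [].
- by move=> w w' _ h v; rewrite h.
- by move=> w w' w'' _ h _ h' v; rewrite h.
- by move=> w1 w1' w2 w2' _ h1 _ h2 v; rewrite !ad_word_cat h2 h1.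
- by move=> x y z h1 h2 h3 v; apply: ad_exp_comm.
- by move=> x y h v; apply: ad_exp_comm0.
- by move=> x y z h hz v; apply: ad_exp_add.
- move=> x h [[p u] c]; rewrite h /ad_lie /=.
  by rewrite trmx0 !mulmx0 mul0mx mxE !subr0 addr0.
- by [].
- by [].
- by [].
Qed.

Lemma ad_word_perm (R : realType) (s : 'S_6) (w : word R) (v : linform R) :
  ad_word (perm_word s w) (ad_perm s v) = ad_perm s (ad_word w v).
Proof.
elim: w => //= l w ->; case: l => [x|b hb] //=.
rewrite log_perm /ad_lie /ad_perm /=.
case: (ad_word w v) => [[p u] c] /=; case: (log x) => [M a] /=.
have hs : perm_mx s *m perm_mx s^-1 = 1%:M :> 'M[int]_6.
  by rewrite -perm_mxM mulgV perm_mx1.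
have hc : (mxC R (p *m perm_mx s))^T = perm_mx s^-1 *m (mxC R p)^T.
  by rewrite mxCM trmx_mul /mxC map_perm_mx tr_perm_mx.
congr ((_, _), _).
- by rewrite !trmx_mul tr_perm_mx tr_perm_mx invgK !mulmxBl !mulmxA
    -[p *m _ *m _]mulmxA hs mulmx1.
- by rewrite mulmxDl !mulmxA -[u *m _ *m _]mulmxA hs mulmx1.
- rewrite hc mulmxA -[a *m _ *m _]mulmxA -perm_mxM mulgV perm_mx1.
  by rewrite mulmx1.
Qed.

Lemma AdM (R : realType) (g h : NS6 R) (v : linform R) :
  Ad (g * h)%g v = Ad g (Ad h v).
Proof.
case: g h => [x s] [y t]; rewrite /Ad /=.
have [a ->] := NA3_ex x; have [b ->] := NA3_ex y.
have repr_ad w u : ad_word (generic_quotient.repr (\pi_(NA3 R) w)) u =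
    ad_word w u.
  by apply: ad_bch; apply: NA3_repr.
rewrite permN_pi mulN_pi !repr_ad ad_word_cat; congr ad_word.
rewrite -ad_word_perm; congr ad_word.
by rewrite /ad_perm /= perm_mxM !mulmxA.
Qed.

Lemma Ad1 (R : realType) (v : linform R) : Ad 1%g v = v.
Proof.
rewrite /Ad (ad_bch _ (NA3_repr [::])) /ad_perm perm_mx1 !mulmx1.
by case: v => [[]].
Qed.

(* F stands for the formal sum  sum_m F(m) e^m  over all m = (a, b), where
   e^m = exp (sum_i a_i p_i + sum_i b_i u_i); the elements of W(A_3) are those
   with finitely many nonzero F(m). *)
Definition fser (R : realType) : Type := expo -> R[i].

Definition fexp (R : realType) (v : linform R) : fser R :=
  fun m => if m == v.1 then Cexp v.2 else 0.

Definition fscale (R : realType) (c : R[i]) (F : fser R) : fser R :=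
  fun m => c * F m.

(* [m, n] = hbar * omega m n. *)
Definition omega (m n : expo) : int :=
  \sum_(i < 6) (m.1 0 i * n.2 0 i - m.2 0 i * n.1 0 i).

(* Bilinear extension of e^m e^n = e^([m, n] / 2) e^(m + n).  The product of
   two arbitrary series makes sense only if every coefficient is a finite sum,
   which is the case on What below; infinite sums take the value 0. *)
Definition fmul (R : realType) (hbar : R[i]) (F G : fser R) : fser R :=
  fun m => \sum_(n \in [set: expo])
    F n * G (m - n) * Cexp (hbar * (omega n (m - n))%:~R / 2%:R).

Definition fone (R : realType) : fser R := fexp 0.

Definition fpow (R : realType) (hbar : R[i]) (F : fser R) (n : nat) : fser R :=
  iter n (fmul hbar F) (@fone R).

(* Ad(g)(sum_m F(m) e^m) = sum_m F(m) e^(Ad(g) m). *)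
Definition fAd (R : realType) (g : NS6 R) (F : fser R) : fser R :=
  fun m => \sum_(n \in [set: expo]) F n * fexp (Ad g (n, 0)) m.

(* The subfield Q(q) of the complex numbers. *)
Definition Qq (R : realType) (q : R[i]) : set R[i] :=
  [set x | exists f g : {poly rat},
     (map_poly ratr g).[q] != 0 /\
     x = (map_poly ratr f).[q] / (map_poly ratr g).[q]].

Definition arrows : seq (nat * nat) :=
  [:: (1, 2); (3, 4); (4, 5); (6, 7); (7, 8); (8, 9);
      (5, 8); (8, 4); (4, 7); (7, 3); (2, 4); (4, 1)]%N.
Definition dashed_arrows : seq (nat * nat) :=
  [:: (9, 5); (5, 2); (1, 3); (3, 6)]%N.

(* 2 b_ij, an integer. *)
Definition b2 (i j : 'I_9) : int :=
  let a (s : seq (nat * nat)) (x y : 'I_9) : int :=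
    Posz (count_mem (x.+1, y.+1) s) in
  (a arrows i j - a arrows j i) *+ 2
  + (a dashed_arrows i j - a dashed_arrows j i).

(* f stands for  sum_k f(k) Y_1^(k_1) ... Y_9^(k_9). *)
Definition yexpo : Type := {ffun 'I_9 -> nat}.
Definition yser (R : realType) : Type := yexpo -> R[i].

(* Y^k Y^l = q^(sum_(j < i) 2 b_ij k_i l_j) Y^(k + l), from
   Y_i Y_j = q^(2 b_ij) Y_j Y_i. *)
Definition ymul (R : realType) (q : R[i]) (f g : yser R) : yser R :=
  fun n => \sum_(kl \in [set kl : yexpo * yexpo |
                         forall i, (kl.1 i + kl.2 i)%N = n i])
    f kl.1 * g kl.2 *
    q ^ (\sum_(i < 9) \sum_(j < 9 | (j < i)%N) b2 i j *+ (kl.1 i * kl.2 j)).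

Definition yone (R : realType) : yser R :=
  fun k => if k == [ffun=> 0%N] then 1 else 0.

Definition Ahat (R : realType) (q : R[i]) : set (yser R) :=
  [set f | forall k, Qq q (f k)].

Definition Ahat_unit (R : realType) (q : R[i]) : set (yser R) :=
  [set f | Ahat q f /\ exists g, Ahat q g /\
     ymul q f g = @yone R /\ ymul q g f = @yone R].

Definition kappa (R : realType) (lam : 'I_6 -> R[i]) (i : nat) : R[i] :=
  Cexp (lam (ix i)).

Definition pn (R : realType) (i : nat) : linform R := pv R (ix i).
Definition un (R : realType) (i : nat) : linform R := uv R (ix i).

Definition phiY (R : realType) (lam : 'I_6 -> R[i]) (i : 'I_9) : fser R :=
  nth (@fone R)
  [:: fscale (kappa lam 3)^-1 (fexp (pn R 3 - un R 3 - pn R 2));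
      fscale (kappa lam 3) (fexp (pn R 3 + un R 3 - pn R 5));
      fscale (kappa lam 2)^-1 (fexp (pn R 2 - un R 2 - pn R 1));
      fscale (kappa lam 2 * (kappa lam 5)^-1)
        (fexp (pn R 2 + un R 2 + pn R 5 - un R 5 - pn R 3 - pn R 4));
      fscale (kappa lam 5) (fexp (pn R 5 + un R 5 - pn R 6));
      fscale (kappa lam 1)^-1 (fexp (pn R 1 - un R 1));
      fscale (kappa lam 1 * (kappa lam 4)^-1)
        (fexp (pn R 1 + un R 1 + pn R 4 - un R 4 - pn R 2));
      fscale (kappa lam 4 * (kappa lam 6)^-1)
        (fexp (pn R 4 + un R 4 + pn R 6 - un R 6 - pn R 5));
      fscale (kappa lam 6) (fexp (pn R 6 + un R 6))] i.

Definition phi_mono (R : realType) (hbar : R[i]) (lam : 'I_6 -> R[i])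
    (k : yexpo) : fser R :=
  \big[fmul hbar / @fone R]_(i < 9) fpow hbar (phiY lam i) (k i).

(* The exponents of the phi(Y_i) are linearly independent, so that at most one
   k contributes to each coefficient. *)
Definition phi (R : realType) (hbar : R[i]) (lam : 'I_6 -> R[i]) (f : yser R) :
    fser R :=
  fun m => \sum_(k \in [set: yexpo]) f k * phi_mono hbar lam k m.

Definition What (R : realType) (hbar : R[i]) (lam : 'I_6 -> R[i]) :
    set (fser R) :=
  phi hbar lam @` Ahat (Cexp hbar).

Definition What_unit (R : realType) (hbar : R[i]) (lam : 'I_6 -> R[i]) :
    set (fser R) :=
  phi hbar lam @` Ahat_unit (Cexp hbar).

(* (F, g) stands for the product F g. *)
Definition sdp (R : realType) : Type := (fser R * NS6 R)%type.

Definition sdmul (R : realType) (hbar : R[i]) (x y : sdp R) : sdp R :=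
  (fmul hbar x.1 (fAd x.2 y.1), (x.2 * y.2)%g).

(* The product x y_1 ... y_r is formed inside What_unit: in each step
   (F, g)(F', g') = (F Ad(g)(F'), g g') both F and Ad(g)(F') lie in it.  This
   is required of the operands instead of g in G: no P_ijk below satisfies
   Ad(P_ijk)(phi(Y)) <= phi(Y), e.g. Ad(P_456)(phi(Y_5)) is a multiple of
   exp (2 p_4 - p_5 + p_6 + u_6), which does not commute with
   exp (p_1 - p_2 + p_4 - u_1 + u_4) although every phi(Y_i) does. *)
Fixpoint sddefined (R : realType) (hbar : R[i]) (lam : 'I_6 -> R[i])
    (x : sdp R) (s : seq (sdp R)) : Prop :=
  if s is y :: s' then
    [/\ What_unit hbar lam x.1, What_unit hbar lam (fAd x.2 y.1)
      & sddefined hbar lam (sdmul hbar x y) s']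
  else What_unit hbar lam x.1.

(* Psi_q(U) = sum_n (- q U)^n / (q^2; q^2)_n. *)
Definition qdilog (R : realType) (hbar : R[i]) (U : fser R) : fser R :=
  let q := Cexp hbar in
  fun m => \sum_(n \in [set: nat])
    (- q) ^+ n / (\prod_(k < n) (1 - q ^+ 2 * (q ^+ 2) ^+ k)) * fpow hbar U n m.

Definition expN (R : realType) (x : ngen R) : NS6 R :=
  (\pi_(NA3 R) [:: EXP x], 1%g).

(* e^(p_i u_j / hbar), for i != j. *)
Definition epu (R : realType) (i j : 'I_6) : NS6 R :=
  if @idP (i != j) is ReflectT h then expN (GPU R h false) else 1%g.

(* e^(a u_i / hbar). *)
Definition eu (R : realType) (a : R[i]) (i : 'I_6) : NS6 R := expN (GU i a).

Definition rho (R : realType) (j k : 'I_6) : NS6 R := (oneN R, tperm j k).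

(* The exponents in e^(p_i (u_k - u_j) / hbar) = e^(p_i u_k / hbar)
   (e^(p_i u_j / hbar))^-1 commute, and likewise for
   e^(c (u_k - u_i) / hbar), where c = lambda_j - lambda_k. *)
Definition Pop (R : realType) (lam : 'I_6 -> R[i]) (i j k : nat) : NS6 R :=
  let c := lam (ix j) - lam (ix k) in
  (rho R (ix j) (ix k) * (epu R (ix i) (ix k) * (epu R (ix i) (ix j))^-1)
   * (eu c (ix k) * (eu c (ix i))^-1))%g.

Definition Rop (R : realType) (hbar : R[i]) (lam : 'I_6 -> R[i])
    (i j k : nat) : sdp R :=
  (qdilog hbar (fexp (pn R i + un R i + pn R k - un R k - pn R j
                      + cst (lam (ix i) - lam (ix k)))),
   Pop lam i j k).

(* Main.v *)
(** Part (1).  Write P_ijk = n_ijk rho_jk with n_ijk in N(A_3) and move all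
    transpositions to the right.  Conjugating by T_ab = e^(p_a u_b / hbar) only
    shears a product of e^(c_i u_i / hbar), so these are collected to the left
    and compared as vectors of C^6.  What remains is an identity between the
    T_ab, which satisfy the Steinberg relations.  With X = T_45 T_46^-1,
    Y = T_23 T_25^-1, Z = T_15 T_16^-1, W = T_12 T_14^-1, V = T_13 T_15^-1 it
    reads X Y Z W = W V X Y, and follows from Y W = V W Y and X W = Z^-1 W X
    because Z commutes with X, Y, W and V commutes with X, W.

    Part (2).  The adjoint actions turn the arguments of the four dilogarithms
    into monomials in the Y_i (normalised as exponentials), and the identity
    becomes
      Psi(Y_8) Psi(Y_4) Psi(Y_7 Y_8) Psi(Y_7)
        = Psi(Y_7) Psi(Y_4 Y_7) Psi(Y_8) Psi(Y_4),
    which is two pentagon identities, for (Y_7, Y_8) and (Y_4, Y_7), and two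
    commutations.  Every series involved is the image of a family of
    coefficients under a map to exponents with finite fibres, so that products
    are computed by reindexing; for the pentagon this leaves the identity
      sum_n (-1)^n p^(n(n-1)/2) / ((p)_(b-n) (p)_n (p)_(a-n))
        = p^(ab) / ((p)_a (p)_b),  p = q^2,
    proved by induction on a. *)
Require Import Defs.
From mathcomp Require Import all_boot all_order all_algebra fingroup perm.
From mathcomp Require Import finmap complex.
From mathcomp Require Import boolp classical_sets functions cardinality.
From mathcomp Require Import fsbigop reals.
From mathcomp Require Import exp trigo ring zify.
Set Implicit Arguments.
Unset Strict Implicit.
Unset Printing Implicit Defensive.
Import Order.TTheory GRing.Theory Num.Theory.
Local Open Scope classical_set_scope.
Local Open Scope ring_scope.

(** * Families of coefficients summed along a map *)

Section Push.
Variable K : fieldType.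

Definition ffib (J G : choiceType) (e : J -> G) : Prop :=
  forall m, finite_set (e @^-1` [set m]).

(* The sum has the junk value 0 when infinitely many of its terms are nonzero,
   hence the hypotheses [ffib] below. *)
Definition push (J G : choiceType) (e : J -> G) (c : J -> K) : G -> K :=
  fun m => \sum_(j \in e @^-1` [set m]) c j.

Lemma eq_push (J G : choiceType) (e e' : J -> G) (c c' : J -> K) :
  e =1 e' -> c =1 c' -> push e c = push e' c'.
Proof. by move=> /funext -> /funext ->. Qed.

Lemma push_id (G : choiceType) (f : G -> K) : push id f = f.
Proof. by apply/funext => m; rewrite /push fsbig_set1. Qed.

Lemma ffib_inj (J G : choiceType) (e : J -> G) : injective e -> ffib e.
Proof.
move=> inje m; have [[j <-]|h] := pselect (exists j, e j = m).
  by apply: sub_finite_set (finite_set1 j) => i /= /inje.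
by apply: sub_finite_set (finite_set0 J) => i /= hi; apply: h; exists i.
Qed.

Lemma ffib_comp (J G H : choiceType) (e : J -> G) (e' : G -> H) :
  ffib e -> injective e' -> ffib (e' \o e).
Proof.
move=> fe inje m; have [[g gm]|h] := pselect (exists g, e' g = m).
  by apply: sub_finite_set (fe g) => i /=; rewrite -gm => /inje.
by apply: sub_finite_set (finite_set0 J) => i /= hi; apply: h; exists (e i).
Qed.

Lemma ffibX (J J' G G' : choiceType) (e : J -> G) (e' : J' -> G') :
  ffib e -> ffib e' -> ffib (fun j : J * J' => (e j.1, e' j.2)).
Proof.
move=> fe fe' [m m']; apply: sub_finite_set (finite_setX (fe m) (fe' m')).
by move=> [j j'] /= [-> ->].
Qed.

(** The finite fibre of the composite is sorted by the value of [e]. Every fibre of [e] lies inside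
    one of [e' \o e], so the inner sums are finite as well. *)
Lemma push_comp (J G H : choiceType) (e : J -> G) (e' : G -> H) (c : J -> K) :
  ffib (e' \o e) -> push e' (push e c) = push (e' \o e) c.
Proof.
move=> fe; apply/funext => m; rewrite {1 3}/push.
have finA := fe m; set A := _ @^-1` _ in finA *.
rewrite (fsbig_fwiden (fset_set A)) ?fset_setK//; last first.
  by rewrite setDv => x.
(* Points outside the image of [A] carry an empty inner sum, so the fibre of [e'], which may be
   infinite, can be replaced by that finite image. *)
have -> : \sum_(n \in e' @^-1` [set m]) push e c n =
          \sum_(n \in e @` A) push e c n.
  apply/esym/fsbig_widen => [_ [j Aj <-]//|n [/= nm An]].
  rewrite /push fsbig1// => j /= ej; case: An; exists j => //.
  by rewrite /A /= ej.
have finI : finite_set (e @` A) by exact: finite_image.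
rewrite (fsbig_fwiden (fset_set (e @` A))) ?fset_setK//; last first.
  by rewrite setDv => x.
rewrite (partition_big_imfset _ e) /=.
have -> : fset_set (e @` A) = [fset e i | i in fset_set A]%fset.
  apply/fsetP => x; rewrite in_fset_set//; apply/idP/imfsetP => /=.
    by rewrite inE => -[j Aj <-]; exists j => //; rewrite in_fset_set// inE.
  by move=> [j + ->]; rewrite in_fset_set// !inE => Aj; exists j.
apply: eq_big_seq => n /imfsetP [j0 /=]; rewrite in_fset_set// inE => Aj0 ->.
have fe1 : finite_set (e @^-1` [set e j0]).
  by apply: sub_finite_set finA => j /= ej; rewrite /A /= ej.
rewrite /push (fsbig_fwiden (fset_set (e @^-1` [set e j0]))) ?fset_setK//;
  last first.
  by rewrite setDv => x.
rewrite -[RHS]big_filter; apply: perm_big; apply: uniq_perm => //.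
  exact: filter_uniq.
move=> x; rewrite mem_filter !in_fset_set//; apply/idP/andP.
  by rewrite inE => /= exj; rewrite exj eqxx inE; split => //;
    rewrite /A /= exj.
by move=> [/eqP exj _]; rewrite inE.
Qed.

Lemma push_prod (J J' G G' : choiceType) (e : J -> G) (e' : J' -> G')
    (c : J -> K) (c' : J' -> K) :
  ffib e -> ffib e' ->
  push (fun j : J * J' => (e j.1, e' j.2)) (fun j => c j.1 * c' j.2) =
  (fun n : G * G' => push e c n.1 * push e' c' n.2).
Proof.
move=> fe fe'; apply/funext => -[m m']; rewrite {2}/push /= mulr_fsuml.
under [RHS]eq_fsbigr do rewrite mulr_fsumr.
rewrite pair_fsbig//; apply: eq_fsbigl.
by apply/seteqP; split => -[j j'] /=; [case=> -> -> | case=> -> ->].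
Qed.

Lemma push_mulr (J G : choiceType) (e : J -> G) (c : J -> K) (d : G -> K) :
  (fun m => push e c m * d m) = push e (fun j => c j * d (e j)).
Proof.
apply/funext => m; rewrite /push mulr_fsuml; apply: eq_fsbigr => j.
by rewrite inE /= => ->.
Qed.

Lemma push_reindex (J J' G : choiceType) (e : J -> G) (c : J -> K)
    (s : J' -> J) : bijective s ->
  push (fun j => e (s j)) (fun j => c (s j)) = push e c.
Proof.
move=> [t st ts]; apply/funext => m; rewrite /push.
apply/esym/(reindex_fsbig s); split => //=.
  by move=> i j _ _ /(congr1 t); rewrite !st.
by move=> j /= <-; exists (t j); rewrite /= ts.
Qed.

(** The twisted convolution attached to a rule e^m e^n = chi(m, n) e^(m + n). Both [fmul] and [ymul]
    are instances. *)
Definition conv (G : nmodType) (chi : G -> G -> K) (f g : G -> K) : G -> K :=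
  push (fun n : G * G => n.1 + n.2) (fun n => f n.1 * g n.2 * chi n.1 n.2).

(** Addition of exponents factors through the pair of exponents. On pairs the family is a plain
    product, and the twist depends on the pair only. *)
Lemma conv_push (J J' : choiceType) (G : nmodType) (chi : G -> G -> K)
    (e : J -> G) (e' : J' -> G) (c : J -> K) (c' : J' -> K) :
  ffib e -> ffib e' -> ffib (fun j : J * J' => e j.1 + e' j.2) ->
  conv chi (push e c) (push e' c') =
  push (fun j : J * J' => e j.1 + e' j.2)
       (fun j => c j.1 * c' j.2 * chi (e j.1) (e' j.2)).
Proof.
move=> fe fe' fee.
pose ee (j : J * J') := (e j.1, e' j.2).
rewrite -[RHS](@push_comp _ _ _ ee (fun n => n.1 + n.2)) //.
rewrite -(push_mulr ee (fun j => c j.1 * c' j.2) (fun n => chi n.1 n.2)).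
by rewrite push_prod.
Qed.

(** The second hypothesis is the 2-cocycle identity. Both bracketings become sums over triples,
    which it matches term by term. *)
Lemma convA (G : nmodType) (chi : G -> G -> K) :
  ffib (fun n : G * G => n.1 + n.2) ->
  (forall k l r, chi k l * chi (k + l) r = chi l r * chi k (l + r)) ->
  associative (conv chi).
Proof.
move=> fadd hchi f g h.
have fid : ffib (@id G) by exact: ffib_inj.
have fadd3 : ffib (fun n : G * G * G => n.1.1 + n.1.2 + n.2).
  move=> m; have := bigcup_finite (fadd m) (fun n _ => ffibX fadd fid n).
  apply: sub_finite_set => n /= nm.
  by exists (n.1.1 + n.1.2, n.2).
pose asw (n : G * G * G) := (n.1.1, (n.1.2, n.2)).
have asw_bij : bijective asw.
  by exists (fun n => (n.1, n.2.1, n.2.2)) => [[[]]|[? []]].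
have fadd3' : ffib (fun n : G * (G * G) => n.1 + (n.2.1 + n.2.2)).
  move=> m; have := finite_image (fun n => (n.1.1, (n.1.2, n.2))) (fadd3 m).
  apply: sub_finite_set => -[a [b c]] /= <-; exists (a, b, c) => //=.
  by rewrite addrA.
have := conv_push chi f (fun n => g n.1 * h n.2 * chi n.1 n.2) fid fadd fadd3'.
rewrite push_id -/(conv chi g h) => ->.
have := conv_push chi (fun n => f n.1 * g n.2 * chi n.1 n.2) h fadd fid fadd3.
rewrite push_id -/(conv chi f g) => ->.
rewrite -[LHS](push_reindex _ _ asw_bij); apply: eq_push => -[[k l] r] /=.
  by rewrite addrA.
transitivity (f k * g l * h r * (chi l r * chi k (l + r))); first by ring.
by rewrite -hchi; ring.
Qed.

End Push.

(** * Exponentials and formal series *)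

Section Cexp.
Variable R : realType.
Implicit Types (a b : R[i]).

Lemma CexpD a b : Cexp (a + b) = Cexp a * Cexp b.
Proof.
case: a b => [a1 a2] [b1 b2]; rewrite /Cexp /= expRD cosD sinD.
by apply/eqP; rewrite eq_complex /=; apply/andP; split; apply/eqP; ring.
Qed.

Lemma Cexp0 : Cexp 0 = 1 :> R[i].
Proof. by rewrite /Cexp /= expR0 cos0 sin0 mulr1 mulr0. Qed.

Lemma CexpNK a : Cexp (- a) * Cexp a = 1.
Proof. by rewrite -CexpD addNr Cexp0. Qed.

Lemma Cexp_neq0 a : Cexp a != 0.
Proof.
by apply/eqP => a0; move: (CexpNK a); rewrite a0 mulr0 => /esym/eqP;
  rewrite oner_eq0.
Qed.

Lemma CexpN a : Cexp (- a) = (Cexp a)^-1.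
Proof. by apply: (mulIf (Cexp_neq0 a)); rewrite CexpNK mulVf// Cexp_neq0. Qed.

Lemma CexpMn a n : Cexp (a *+ n) = Cexp a ^+ n.
Proof.
elim: n => [|n IH]; first by rewrite Cexp0.
by rewrite mulrS exprS CexpD IH.
Qed.

Lemma Cexp_int a (n : int) : Cexp (a * n%:~R) = Cexp a ^ n.
Proof.
case: n => n; first by rewrite mulr_natr CexpMn.
by rewrite NegzE rmorphN mulrN CexpN mulr_natr CexpMn.
Qed.

End Cexp.

Section Omega.

Lemma omegaDl m n k : omega (m + n) k = omega m k + omega n k.
Proof.
rewrite /omega -big_split /=; apply: eq_bigr => i _; rewrite !mxE; ring.
Qed.

Lemma omegaC m n : omega m n = - omega n m.
Proof. by rewrite /omega -sumrN; apply: eq_bigr => i _; ring. Qed.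

Lemma omegaDr m n k : omega m (n + k) = omega m n + omega m k.
Proof. by rewrite omegaC omegaDl opprD -!(omegaC m). Qed.

Lemma omegaxx m : omega m m = 0.
Proof. by rewrite /omega big1// => i _; ring. Qed.

Lemma omega0l m : omega 0 m = 0.
Proof. by rewrite /omega big1// => i _; rewrite !mxE; ring. Qed.

Lemma omegaMnl m n k : omega (m *+ k) n = omega m n *+ k.
Proof.
elim: k => [|k IH]; first exact: omega0l.
by rewrite !mulrS omegaDl IH.
Qed.

Lemma omegaMnr m n k : omega m (n *+ k) = omega m n *+ k.
Proof. by rewrite omegaC omegaMnl -mulNrn -omegaC. Qed.

Lemma omega_suml (I : Type) (r : seq I) (P : pred I) (F : I -> expo) n :
  omega (\sum_(i <- r | P i) F i) n = \sum_(i <- r | P i) omega (F i) n.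
Proof.
by apply: (big_morph (fun m => omega m n)) => [m k|];
  [exact: omegaDl | exact: omega0l].
Qed.

Lemma omega_sumr (I : Type) (r : seq I) (P : pred I) (F : I -> expo) n :
  omega n (\sum_(i <- r | P i) F i) = \sum_(i <- r | P i) omega n (F i).
Proof. by rewrite omegaC omega_suml -sumrN; apply: eq_bigr => i _;
  rewrite -omegaC. Qed.

End Omega.

Section Fser.
Variables (R : realType) (hbar : R[i]).
Implicit Types (F G : fser R) (v w : linform R).

(* e^m e^n = wchi m n e^(m + n). *)
Definition wchi (m n : expo) : R[i] := Cexp (hbar * (omega m n)%:~R / 2%:R).

Lemma fmulE F G : fmul hbar F G = conv wchi F G.
Proof.
apply/funext => m; rewrite /fmul /conv /push.
rewrite [RHS](reindex_fsbig (fun n => (n, m - n)) [set: expo])//; split => /=.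
- by move=> n _ /=; rewrite addrC subrK.
- by move=> n n' _ _ [].
- by move=> [n n'] /= <-; exists n => //=; rewrite [n + n']addrC addrK.
Qed.

Lemma linform_fstMn v n : (v *+ n).1 = v.1 *+ n.
Proof. by elim: n => // n IH; rewrite !mulrS -IH. Qed.

Lemma linform_sndMn v n : (v *+ n).2 = v.2 *+ n.
Proof. by elim: n => // n IH; rewrite !mulrS -IH. Qed.

Lemma fexpE v : fexp v = push (fun _ : unit => v.1) (fun=> Cexp v.2).
Proof.
apply/funext => m; rewrite /fexp /push; case: eqP => [->|mv].
  rewrite (_ : _ @^-1` _ = [set tt]) ?fsbig_set1//.
  by apply/seteqP; split => -[].
by rewrite fsbig1// => -[] /= /esym.
Qed.

Lemma ffib_fin (J : finType) (G : choiceType) (e : J -> G) : ffib e.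
Proof. by move=> m; exact: finite_finset. Qed.

Lemma fmul_fexp v w : fmul hbar (fexp v) (fexp w) =
  fexp (v + w + Defs.cst (hbar * (omega v.1 w.1)%:~R / 2%:R)).
Proof.
rewrite fmulE !fexpE conv_push; do ?exact: ffib_fin.
have s_bij : bijective (fun _ : unit => (tt, tt)).
  by exists (fun=> tt) => [[]|[[] []]].
rewrite -[LHS](push_reindex _ _ s_bij); apply: eq_push => -[] /=.
  by rewrite addr0.
by rewrite /wchi !CexpD.
Qed.

Lemma cst0 : Defs.cst (0 : R[i]) = 0. Proof. by []. Qed.

Lemma fpow_fexp v n : fpow hbar (fexp v) n = fexp (v *+ n).
Proof.
elim: n => // n IH; rewrite /fpow iterS -/(fpow _ _ _) IH fmul_fexp.
by rewrite linform_fstMn omegaMnr omegaxx mul0rn mulr0 mul0r cst0 addr0 mulrS.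
Qed.

Definition dcoef (q : R[i]) (n : nat) : R[i] :=
  (- q) ^+ n / (\prod_(k < n) (1 - q ^+ 2 * (q ^+ 2) ^+ k)).

Lemma qdilogE v : qdilog hbar (fexp v) =
  push (fun n => v.1 *+ n) (fun n => dcoef (Cexp hbar) n * Cexp (v.2 *+ n)).
Proof.
apply/funext => m; rewrite /qdilog /push [RHS]fsbig_mkcond.
apply: eq_fsbigr => n _; rewrite fpow_fexp /fexp linform_fstMn linform_sndMn.
rewrite /patch; case: eqP => [->|mv]; case: ifPn => //.
- by rewrite notin_setE => /(_ erefl).
- by rewrite inE /= => /esym.
- by rewrite mulr0.
Qed.

Lemma expo_mulrn_inj (m : expo) : m != 0 -> injective (fun n => m *+ n).
Proof.
case: m => [a b] ab0 n n' /= h.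
have fstMn k : ((a, b) *+ k : expo) = (a *+ k, b *+ k).
  by elim: k => // k IH; rewrite !mulrS IH.
move: h; rewrite !fstMn => -[ha hb]; apply/eqP; apply: contraNT ab0 => nn'.
have h0 (c : 'rV[int]_6) : c *+ n = c *+ n' -> c = 0.
  move=> /rowP hc; apply/rowP => j; have := hc j.
  rewrite !mxE !mulmxnE -mulr_natr -[RHS]mulr_natr => /eqP;
    rewrite -subr_eq0 -mulrBr mulf_eq0.
  by rewrite subr_eq0 eqr_nat (negPf nn') orbF => /eqP.
by rewrite (h0 _ ha) (h0 _ hb).
Qed.

End Fser.

(** * The quantum torus of the Y_i *)

Section Ydata.

(* Row i of yp and yu: coefficients of the p_j and of the u_j in the exponent
   of phi(Y_(i+1)). *)
Definition yp : seq (seq int) :=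
  [:: [:: 0; -1; 1; 0; 0; 0]; [:: 0; 0; 1; 0; -1; 0]; [:: -1; 1; 0; 0; 0; 0];
      [:: 0; 1; -1; -1; 1; 0]; [:: 0; 0; 0; 0; 1; -1]; [:: 1; 0; 0; 0; 0; 0];
      [:: 1; -1; 0; 1; 0; 0]; [:: 0; 0; 0; 1; -1; 1]; [:: 0; 0; 0; 0; 0; 1]].
Definition yu : seq (seq int) :=
  [:: [:: 0; 0; -1; 0; 0; 0]; [:: 0; 0; 1; 0; 0; 0]; [:: 0; -1; 0; 0; 0; 0];
      [:: 0; 1; 0; 0; -1; 0]; [:: 0; 0; 0; 0; 1; 0]; [:: -1; 0; 0; 0; 0; 0];
      [:: 1; 0; 0; -1; 0; 0]; [:: 0; 0; 0; 1; 0; -1]; [:: 0; 0; 0; 0; 0; 1]].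

Definition yexp (i : 'I_9) : expo :=
  (\row_j (nth [::] yp i)`_j, \row_j (nth [::] yu i)`_j).

(** A copy of [b2] on bare numbers, so that the 81 cases of [b2_omega] can be evaluated. *)
Definition b2nat (i j : nat) : int :=
  let a (s : seq (nat * nat)) (x y : nat) : int :=
    Posz (count_mem (x.+1, y.+1) s) in
  (a arrows i j - a arrows j i) *+ 2
  + (a dashed_arrows i j - a dashed_arrows j i).

(** Compatibility of [phi] with the relations of the Y_i: exchanging two exponentials costs q to the
    power [omega]. With the tables [yp] and [yu] it is a finite computation. *)
Lemma b2_omega i j : b2 i j = omega (yexp i) (yexp j).
Proof.
pose om (i j : nat) : int := foldr (fun s t =>
  (nth [::] yp i)`_s * (nth [::] yu j)`_s -
  (nth [::] yu i)`_s * (nth [::] yp j)`_s + t) 0 (iota 0 6).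
have -> : omega (yexp i) (yexp j) = om i j.
  rewrite /omega /om !big_ord_recl big_ord0 !mxE.
  by [].
have /allP/(_ (val i)) : all (fun i => all (fun j =>
  b2nat i j == om i j) (iota 0 9)) (iota 0 9).
  by vm_compute.
rewrite mem_iota ltn_ord => /(_ isT)/allP/(_ (val j)).
by rewrite mem_iota ltn_ord => /(_ isT)/eqP.
Qed.

Definition yexp_sum (k : yexpo) : expo := \sum_i yexp i *+ k i.

Lemma yexp_sumD k l : yexp_sum (k + l) = yexp_sum k + yexp_sum l.
Proof. by rewrite /yexp_sum -big_split; apply: eq_bigr => i _;
  rewrite ffunE mulrnDr. Qed.

(** The nine exponents are linearly independent: their twelve coordinates give a linear system
    settled by [lia]. Hence [phi] never merges two monomials. *)
Lemma yexp_sum_inj : injective yexp_sum.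
Proof.
(* Integer values indexed by plain numbers, so that [lia] sees nine atoms per exponent. *)
pose kk (k : yexpo) n : int := k (inord n).
have Mn m (c : int) : c *+ m = c * m%:Z by rewrite -mulr_natr natz.
have Ep k (s : 'I_6) : (yexp_sum k).1 0 s =
  \sum_(i < 9) (nth [::] yp i)`_s * kk k i.
  rewrite /yexp_sum (@big_morph _ _ (fun m : expo => m.1 0 s) 0 +%R) =>
    [|m n|]; rewrite ?mxE//.
  apply: eq_bigr => i _; rewrite /kk inord_val -Mn.
  by elim: (k i) => [|n IH]; rewrite ?mxE// !mulrS [LHS]mxE IH mxE.
have Eu k (s : 'I_6) : (yexp_sum k).2 0 s =
  \sum_(i < 9) (nth [::] yu i)`_s * kk k i.
  rewrite /yexp_sum (@big_morph _ _ (fun m : expo => m.2 0 s) 0 +%R) =>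
    [|m n|]; rewrite ?mxE//.
  apply: eq_bigr => i _; rewrite /kk inord_val -Mn.
  by elim: (k i) => [|n IH]; rewrite ?mxE// !mulrS [LHS]mxE IH mxE.
move=> k l kl.
have kkl n : (n < 9)%N -> kk k n = kk l n.
  have P (s : 'I_6) : \sum_(i < 9) (nth [::] yp i)`_s * kk k i =
    \sum_(i < 9) (nth [::] yp i)`_s * kk l i.
    by rewrite -!Ep kl.
  have U (s : 'I_6) : \sum_(i < 9) (nth [::] yu i)`_s * kk k i =
    \sum_(i < 9) (nth [::] yu i)`_s * kk l i.
    by rewrite -!Eu kl.
  have := P (@Ordinal 6 0 isT); have := P (@Ordinal 6 1 isT).
  have := P (@Ordinal 6 2 isT); have := P (@Ordinal 6 3 isT).
  have := P (@Ordinal 6 4 isT); have := P (@Ordinal 6 5 isT).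
  have := U (@Ordinal 6 0 isT); have := U (@Ordinal 6 1 isT).
  have := U (@Ordinal 6 2 isT); have := U (@Ordinal 6 3 isT).
  have := U (@Ordinal 6 4 isT); have := U (@Ordinal 6 5 isT).
  rewrite !big_ord_recl !big_ord0 /= /bump /=.
  rewrite !(add1n, add0n).
  by case: n => [|[|[|[|[|[|[|[|[|//]]]]]]]]] /= *; lia.
apply/ffunP => i; have := kkl i (ltn_ord i).
by rewrite /kk inord_val => -[].
Qed.

End Ydata.

(** * Ordered products of exponentials and the images of the Y_i *)

Lemma big_pairs_recl (V : nmodType) n (F : 'I_n.+1 -> 'I_n.+1 -> V) :
  \sum_(i < n.+1) \sum_(j < n.+1 | (i < j)%N) F i j =
  \sum_(j < n) F ord0 (lift ord0 j) +
  \sum_(i < n) \sum_(j < n | (i < j)%N) F (lift ord0 i) (lift ord0 j).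
Proof.
rewrite big_ord_recl; congr (_ + _).
  by rewrite big_mkcond big_ord_recl /= add0r.
apply: eq_bigr => i _; rewrite big_mkcond big_ord_recl /= add0r.
by rewrite [RHS]big_mkcond.
Qed.

Section Phi.
Variables (R : realType) (hbar : R[i]).
Local Notation q := (Cexp hbar).

Lemma linform_fst_sum (I : Type) (r : seq I) (F : I -> linform R) :
  (\sum_(i <- r) F i).1 = \sum_(i <- r) (F i).1.
Proof. exact: (@big_morph _ _ (fun m : linform R => m.1) 0 +%R). Qed.

(** By BCH each pair i < j of factors contributes half its commutator; the induction splits off the
    pairs containing the first factor. *)
Lemma big_fmul_fexp n (x : 'I_n -> linform R) :
  \big[fmul hbar / @fone R]_(i < n) fexp (x i) =
  fexp (\sum_i x i + Defs.cst
    (hbar * (\sum_(i < n) \sum_(j < n | (i < j)%N) omega (x i).1 (x j).1)%:~R /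
      2%:R)).
Proof.
elim: n x => [|n IH] x; first by rewrite !big_ord0 mulr0 mul0r addr0.
rewrite [\big[_/_]_(i < _) fexp _]big_ord_recl IH fmul_fexp big_pairs_recl
  [\sum_(i < n.+1) x i]big_ord_recl.
congr fexp; rewrite -!addrA; congr (_ + (_ + _)).
rewrite /= addr0 linform_fst_sum omega_sumr.
rewrite -[LHS]/((0 : expo) + 0, _ + _); congr pair; first exact: addr0.
by rewrite rmorphD /= mulrDr mulrDl addrC.
Qed.

(** The logarithm of phi(Y_(i+1)); the constants come from the factors [kappa]. *)
Definition yform (lam : 'I_6 -> R[i]) (i : 'I_9) : linform R :=
  let l n := lam (ix n) in
  (yexp i, [:: - l 3; l 3; - l 2; l 2 - l 5; l 5; - l 1; l 1 - l 4;
    l 4 - l 6; l 6]`_i).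

Lemma fscale_Cexp c (v : linform R) :
  fscale (Cexp c) (fexp v) = fexp (v + Defs.cst c).
Proof.
apply/funext => m; rewrite /fscale /fexp /= addr0; case: eqP => _;
  last by rewrite mulr0.
by rewrite CexpD mulrC.
Qed.

Lemma pn_fst n : (0 < n <= 6)%N ->
  pn R n = (((\row_j (j == n.-1 :> nat)%:Z, 0) : expo), 0).
Proof.
move=> hn; congr (((_, _) : expo), _).
apply/rowP => j; rewrite !mxE eqxx /= -val_eqE /= /ix inordK;
  last by case: n hn => [|[|[|[|[|[|[]]]]]]].
by case: eqP.
Qed.

Lemma un_fst n : (0 < n <= 6)%N ->
  un R n = (((0, \row_j (j == n.-1 :> nat)%:Z) : expo), 0).
Proof.
move=> hn; congr (((_, _) : expo), _).
apply/rowP => j; rewrite !mxE eqxx /= -val_eqE /= /ix inordK;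
  last by case: n hn => [|[|[|[|[|[|[]]]]]]].
by case: eqP.
Qed.

Lemma phiYE lam i : phiY lam i = fexp (yform lam i).
Proof.
rewrite /phiY /kappa -!CexpN -!CexpD !fscale_Cexp !pn_fst // !un_fst //.
case: i => [[|[|[|[|[|[|[|[|[|//]]]]]]]]] hi] /=; congr fexp.
all: congr ((_, _), _); rewrite /= ?oppr0 ?addr0 ?add0r //;
  apply/rowP => -[[|[|[|[|[|[|//]]]]]] hj]; rewrite !mxE //=.
Qed.

End Phi.

(** * The algebra of power series in the Y_i *)

Section Ymul.
Variables (R : realType) (q : R[i]).
Hypothesis q0 : q != 0.

Definition bform (k l : yexpo) : int :=
  \sum_(i < 9) \sum_(j < 9 | (j < i)%N) b2 i j *+ (k i * l j).

Lemma bformDl k k' l : bform (k + k') l = bform k l + bform k' l.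
Proof.
rewrite /bform -big_split; apply: eq_bigr => i _ /=; rewrite -big_split.
by apply: eq_bigr => j _ /=; rewrite ffunE mulnDl mulrnDr.
Qed.

Lemma bformDr k l l' : bform k (l + l') = bform k l + bform k l'.
Proof.
rewrite /bform -big_split; apply: eq_bigr => i _ /=; rewrite -big_split.
by apply: eq_bigr => j _ /=; rewrite ffunE mulnDr mulrnDr.
Qed.

Lemma bform0l k : bform 0 k = 0.
Proof. by rewrite /bform big1// => i _; rewrite big1// => j _;
  rewrite ffunE. Qed.

Lemma bform0r k : bform k 0 = 0.
Proof. by rewrite /bform big1// => i _; rewrite big1// => j _;
  rewrite ffunE muln0. Qed.

Lemma bformMnl k l n : bform (k *+ n) l = bform k l *+ n.
Proof. by elim: n => [|n IH]; rewrite ?bform0l// !mulrS bformDl IH. Qed.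

Lemma bformMnr k l n : bform l (k *+ n) = bform l k *+ n.
Proof. by elim: n => [|n IH]; rewrite ?bform0r// !mulrS bformDr IH. Qed.

(* Y^k Y^l = ychi k l Y^(k + l). *)
Definition ychi (k l : yexpo) : R[i] := q ^ bform k l.

Lemma ymulE (f g : yser R) : ymul q f g = conv ychi f g.
Proof.
apply/funext => n; rewrite /ymul /conv /push; apply: eq_fsbigl.
apply/seteqP; split => -[k l] /= h; last by move=> i; rewrite -h ffunE.
by apply/ffunP => i; rewrite ffunE -h.
Qed.

Lemma finite_yle (n : yexpo) : finite_set [set k : yexpo | forall i,
  (k i <= n i)%N].
Proof.
pose M := (\sum_i n i)%N.
pose emb (b : {ffun 'I_9 -> 'I_M.+1}) : yexpo := [ffun i => b i : nat].
have fin : finite_set (emb @` setT) by apply: finite_image;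
  exact: finite_finset.
apply: sub_finite_set fin => k /= kn.
have kM i : (k i < M.+1)%N.
  by rewrite ltnS (leq_trans (kn i))// /M (bigD1 i)//= leq_addr.
exists [ffun i => Ordinal (kM i)] => //.
by apply/ffunP => i; rewrite !ffunE.
Qed.

(** Exponents are nonnegative, so both summands are bounded by their sum. This makes each
    coefficient of a product of power series a finite sum. *)
Lemma ffib_yadd : ffib (fun n : yexpo * yexpo => n.1 + n.2).
Proof.
move=> n; have := finite_setX (finite_yle n) (finite_yle n).
apply: sub_finite_set => -[k l] /= <-; split => i /=; rewrite ffunE /=.
  exact: leq_addr.
exact: leq_addl.
Qed.

Lemma ffib_add (J J' : choiceType) (e : J -> yexpo) (e' : J' -> yexpo) :
  ffib e -> ffib e' -> ffib (fun j : J * J' => e j.1 + e' j.2).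
Proof.
move=> fe fe' m; have := bigcup_finite (ffib_yadd m) (fun n _ =>
  ffibX fe fe' n).
by apply: sub_finite_set => j /= jm; exists (e j.1, e' j.2).
Qed.

Lemma yexpo_mulrnE (k : yexpo) n i : (k *+ n) i = (k i * n)%N.
Proof.
elim: n => [|n IH]; first by rewrite ffunE muln0.
by rewrite mulrS ffunE IH mulnS.
Qed.

Lemma yexpo_mulrn_inj (k : yexpo) : k != 0 -> injective (fun n => k *+ n).
Proof.
move=> k0 n n' /ffunP h; case: (pickP (fun i => k i != 0%N)) => [i ki|k0'].
  have /eqP := h i; rewrite !yexpo_mulrnE eqn_pmul2l ?lt0n//.
  by move/eqP.
case/eqP: k0; apply/ffunP => i; have := k0' i; rewrite ffunE => /negbFE/eqP ->.
by [].
Qed.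

(** A power of q whose exponent is a bilinear form is a 2-cocycle. *)
Lemma ymulA : associative (ymul q).
Proof.
move=> f g h; rewrite !ymulE; apply: convA; first exact: ffib_yadd.
move=> k l r; rewrite /ychi -!expfzDr//; congr (_ ^ _).
by rewrite bformDl bformDr addrA addrC.
Qed.

Lemma yone_push : @yone R = push (fun _ : unit => 0) (fun=> 1).
Proof.
apply/funext => m; rewrite /yone /push; case: eqP => [->|mv].
  rewrite (_ : _ @^-1` _ = [set tt]) ?fsbig_set1//.
  by apply/seteqP; split => -[].
rewrite fsbig1// => -[] /= /esym m0; case: mv; rewrite m0.
by apply/ffunP => i; rewrite !ffunE.
Qed.

Lemma ymul1 (f : yser R) : ymul q f (@yone R) = f.
Proof.
have fid : ffib (@id yexpo) by apply: ffib_inj => k l.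
rewrite ymulE yone_push -[f in LHS]push_id conv_push.
- have s_bij : bijective (fun k : yexpo => (k, tt)).
    by exists fst => // -[? []].
  rewrite -[LHS](push_reindex _ _ s_bij) -[RHS]push_id.
  by apply: eq_push => k /=; rewrite ?addr0// /ychi bform0r expr0z !mulr1.
- exact: fid.
- exact: (@ffib_fin unit).
- exact: (ffib_add fid (@ffib_fin unit _ (fun=> 0))).
Qed.

End Ymul.

(** * Multiplicativity of phi *)

Section PhiM.
Variables (R : realType) (hbar : R[i]) (lam : 'I_6 -> R[i]).
Local Notation q := (Cexp hbar).

Definition yquad (k : yexpo) : int :=
  \sum_(i < 9) \sum_(j < 9 | (i < j)%N) omega (yexp i) (yexp j) *+ (k i * k j).

(** The scalar by which the image of the ordered monomial Y^k differs from the pure exponential with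
    exponent [yexp_sum k]; [yquad] collects the commutators between its factors. *)
Definition ycoef (k : yexpo) : R[i] :=
  Cexp ((\sum_i yform lam i *+ k i).2 + hbar * (yquad k)%:~R / 2%:R).

Lemma phi_monoE k m :
  phi_mono hbar lam k m = if m == yexp_sum k then ycoef k else 0.
Proof.
rewrite /phi_mono; under eq_bigr => i _ do rewrite phiYE fpow_fexp.
rewrite big_fmul_fexp /fexp /=.
have -> : (\sum_i yform lam i *+ k i).1 + 0 = yexp_sum k.
  rewrite addr0 linform_fst_sum; apply: eq_bigr => i _.
  by rewrite linform_fstMn.
case: eqP => // _; congr Cexp; congr (_ + _ * _%:~R / _).
apply: eq_bigr => i _; apply: eq_bigr => j _.
by rewrite !linform_fstMn omegaMnl omegaMnr mulrnA mulrnAC.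
Qed.

Lemma phiE (f : yser R) :
  phi hbar lam f = push yexp_sum (fun k => f k * ycoef k).
Proof.
apply/funext => m; rewrite /phi /push [RHS]fsbig_mkcond.
apply: eq_fsbigr => k _; rewrite phi_monoE /patch.
case: eqP => [->|mv]; case: ifPn => //.
- by rewrite notin_setE => /(_ erefl).
- by rewrite inE /= => /esym.
- by rewrite mulr0.
Qed.

(** In [omega] the pairs i < j give [S k l], the pairs j < i give [bform k l], and the diagonal
    vanishes. Polarising [yquad] gives [S k l + S l k], and antisymmetry turns [S l k] into
    [- bform k l]. *)
Lemma yquadD k l :
  omega (yexp_sum k) (yexp_sum l) + yquad k + yquad l =
    bform k l *+ 2 + yquad (k + l).
Proof.
pose W i j := omega (yexp i) (yexp j).
pose S (x y : yexpo) := \sum_(i < 9) \sum_(j < 9 | (i < j)%N) W i j *+ (x i * y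
  j).
have -> : yquad (k + l) = yquad k + yquad l + (S k l + S l k).
  rewrite /yquad /S -!big_split; apply: eq_bigr => i _ /=.
  rewrite -!big_split; apply: eq_bigr => j _ /=; rewrite !ffunE /W.
  by rewrite mulnDl !mulnDr !mulrnDr; ring.
have -> : S l k = - bform k l.
  rewrite /S /bform (exchange_big_dep xpredT) //= -sumrN; apply: eq_bigr => i _.
  rewrite -sumrN; apply: eq_bigr => j _.
  by rewrite b2_omega /W omegaC mulNrn mulnC.
have -> : omega (yexp_sum k) (yexp_sum l) = S k l + bform k l.
  rewrite /yexp_sum omega_suml /S /bform -big_split; apply: eq_bigr => i _ /=.
  rewrite omega_sumr (bigID (fun j : 'I_9 => (i < j)%N)) /=; congr (_ + _).
    by apply: eq_bigr => j _; rewrite omegaMnl omegaMnr -mulrnA mulnC.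
  rewrite [RHS](eq_bigl (fun j : 'I_9 => ~~ (i < j)%N && (i != j))); last first.
    by move=> j; rewrite -leqNgt ltn_neqAle eq_sym andbC.
  rewrite [RHS]big_mkcondr; apply: eq_bigr => j _.
  rewrite omegaMnl omegaMnr b2_omega -mulrnA mulnC; case: eqP => //= <-.
  by rewrite omegaxx mul0rn.
ring.
Qed.

(** The cocycles [ychi] and [wchi] differ by the coboundary of [ycoef], which is why [phi] is
    multiplicative. *)
Lemma ycoefD k l : ycoef k * ycoef l * wchi hbar (yexp_sum k) (yexp_sum l) =
  ychi q k l * ycoef (k + l).
Proof.
rewrite /ycoef /ychi /wchi -Cexp_int -!CexpD; congr Cexp.
have -> : \sum_i yform lam i *+ (k + l)%R i =
    \sum_i yform lam i *+ k i + \sum_i yform lam i *+ l i.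
  by rewrite -big_split; apply: eq_bigr => i _; rewrite ffunE mulrnDr.
rewrite /=; move: (yquadD k l); set a := omega _ _; set b := bform _ _.
move=> /(congr1 (fun z : int => z%:~R : R[i])).
rewrite !rmorphD /= => h.
have -> : b%:~R = (a%:~R + (yquad k)%:~R + (yquad l)%:~R - (yquad (k +
  l))%:~R) / 2%:R :> R[i].
  by rewrite h; field.
by field.
Qed.

Lemma phiM (f g : yser R) :
  phi hbar lam (ymul q f g) = fmul hbar (phi hbar lam f) (phi hbar lam g).
Proof.
have fE : ffib yexp_sum by apply: ffib_inj; exact: yexp_sum_inj.
have fEE : ffib (yexp_sum \o (fun n : yexpo * yexpo => n.1 + n.2)).
  by apply: ffib_comp; [exact: ffib_yadd | exact: yexp_sum_inj].
have eEE : (fun n : yexpo * yexpo => yexp_sum n.1 + yexp_sum n.2) =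
  yexp_sum \o (fun n => n.1 + n.2).
  by apply/funext => n /=; rewrite yexp_sumD.
rewrite fmulE !phiE conv_push// ?eEE// ymulE /conv push_mulr push_comp//.
apply: eq_push => // -[k l] /=; rewrite -!mulrA -ycoefD; ring.
Qed.

End PhiM.

(** * The quantum dilogarithm *)

Section QSeries.
Variables (K : fieldType) (p : K).
Hypothesis p1 : forall n, (0 < n)%N -> p ^+ n != 1.

(** The Pochhammer symbol (p; p)_n. *)
Definition qfac (n : nat) : K := \prod_(k < n) (1 - p * p ^+ k).

(** By Euler, [qsgn n / qfac n] is the coefficient of z^n in (z; p)_oo, the inverse of the series
    with coefficients 1 / (p; p)_n. *)
Definition qsgn (n : nat) : K := (- 1) ^+ n * p ^+ 'C(n, 2).

Lemma qsgnS n : qsgn n.+1 = - p ^+ n * qsgn n.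
Proof. by rewrite /qsgn binS bin1 exprS exprD; ring. Qed.

Lemma qfacS n : (1 - p ^+ n.+1) / qfac n.+1 = (qfac n)^-1.
Proof.
have pn : 1 - p ^+ n.+1 != 0 by rewrite subr_eq0 eq_sym p1.
by rewrite /qfac big_ord_recr /= -exprS invfM mulrCA divff// mulr1.
Qed.

(* Splits 1 - p^(a+1) = (1 - p^(a+1-n)) + p^(a+1-n) (1 - p^n). *)
Lemma qsum_recl (g : nat -> K) a :
  (1 - p ^+ a.+1) * (\sum_(n < a.+2) qsgn n * g n / qfac n / qfac (a.+1 - n)) =
  \sum_(n < a.+1) qsgn n * g n / qfac n / qfac (a - n) -
  p ^+ a * \sum_(n < a.+1) qsgn n * g n.+1 / qfac n / qfac (a - n).
Proof.
rewrite mulr_sumr.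
rewrite (eq_bigr (fun n : 'I_a.+2 =>
    qsgn n * g n / qfac n * ((1 - p ^+ (a.+1 - n)) / qfac (a.+1 - n)) +
    p ^+ (a.+1 - n) * qsgn n * g n *
      ((1 - p ^+ n) / qfac n) / qfac (a.+1 - n))).
  rewrite big_split /=; congr (_ + _).
    rewrite big_ord_recr /= subnn expr0 subrr mul0r mulr0 addr0.
    apply: eq_bigr => n _; rewrite subSn; last by rewrite -ltnS.
    by rewrite qfacS.
  rewrite big_ord_recl /= expr0 subrr mul0r mulr0 mul0r add0r mulr_sumr -sumrN.
  apply: eq_bigr => n _; rewrite /bump /= add1n subSS qfacS qsgnS.
  have -> : p ^+ a = p ^+ (a - n) * p ^+ n by rewrite -exprD subnK// -ltnS.
  ring.
move=> n _; have -> : p ^+ a.+1 = p ^+ (a.+1 - n) * p ^+ n.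
  by rewrite -exprD subnK// -ltnS.
ring.
Qed.

(** Euler's two series are inverse to each other. In the recursion with g = 1 both sums on the right
    are the previous case: they vanish for a > 0, and for a = 0 they cancel because p^0 = 1. *)
Lemma qsum_inv a :
  \sum_(n < a.+1) qsgn n / qfac n / qfac (a - n) = (a == 0%N)%:R.
Proof.
elim: a => [|a IH].
  by rewrite big_ord_recl big_ord0 /qsgn /qfac !big_ord0 /= invr1 !mulr1 addr0.
have := qsum_recl (fun=> 1) a.
have e c : \sum_(n < c.+1) qsgn n * 1 / qfac n / qfac (c - n) =
    \sum_(n < c.+1) qsgn n / qfac n / qfac (c - n).
  by apply: eq_bigr => n _; rewrite mulr1.
rewrite !e IH => h.
have pn : 1 - p ^+ a.+1 != 0 by rewrite subr_eq0 eq_sym p1.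
apply: (mulfI pn); rewrite h mulr0.
by case: (a) => [|b]; rewrite ?mulr0 ?subrr// expr0 mul1r subrr.
Qed.

Lemma qsum_pentagon a b :
  \sum_(n < a.+1 | (n <= b)%N)
    qsgn n / qfac (b - n) / qfac n / qfac (a - n) =
  p ^+ (a * b) / qfac a / qfac b.
Proof.
(* Extending 1 / (p; p)_(b-n) by zero to n > b removes the side condition, so that [qsum_recl]
   applies with g = [C b]. *)
pose C b n : K := if (n <= b)%N then (qfac (b - n))^-1 else 0.
have CE a' b' : \sum_(n < a'.+1 | (n <= b')%N)
    qsgn n / qfac (b' - n) / qfac n / qfac (a' - n) =
    \sum_(n < a'.+1) qsgn n * C b' n / qfac n / qfac (a' - n).
  rewrite big_mkcond; apply: eq_bigr => n _; rewrite /C.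
  by case: ifP => // _; rewrite mulr0 !mul0r.
elim: a b => [|a IH] b.
  rewrite CE big_ord_recl big_ord0 /C leq0n subn0 mul0n /qsgn /qfac !big_ord0
    /=.
  by rewrite invr1 !mulr1 addr0.
rewrite CE.
have pn : 1 - p ^+ a.+1 != 0 by rewrite subr_eq0 eq_sym p1.
apply: (mulfI pn); rewrite qsum_recl -CE IH.
have -> : (1 - p ^+ a.+1) * (p ^+ (a.+1 * b) / qfac a.+1 / qfac b) =
   p ^+ (a.+1 * b) / qfac a / qfac b by rewrite -(qfacS a); ring.
case: b => [|b].
  rewrite big1 => [|n _]; last by rewrite /C /= mulr0 !mul0r.
  by rewrite !muln0 mulr0 subr0.
(* Shifting both arguments leaves [C] unchanged, so this sum is the induction hypothesis at b rather
   than b + 1. *)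
have -> : \sum_(n < a.+1) qsgn n * C b.+1 n.+1 / qfac n / qfac (a - n) =
    p ^+ (a * b) / qfac a / qfac b.
  by rewrite -IH CE; apply: eq_bigr => n _; rewrite /C ltnS subSS.
rewrite -(qfacS b) mulnS mulSn mulnS !exprD; ring.
Qed.

End QSeries.

(** * Commutation and the pentagon identity for the dilogarithm *)

Section Pentagon.
Variables (R : realType) (hbar : R[i]).
Local Notation q := (Cexp hbar).
Hypothesis q1 : forall n, (0 < n)%N -> q ^+ n != 1.

Lemma sqr_not_unity n : (0 < n)%N -> (q ^+ 2) ^+ n != 1.
Proof. by move=> n0; rewrite -exprM q1// muln_gt0. Qed.

Lemma dcoefE n : dcoef q n = (- q) ^+ n / qfac (q ^+ 2) n. Proof. by []. Qed.

(** For p = q^2 the factor p^(n(n-1)/2) is q^(n^2 - n); the signs cancel. The pentagon uses this for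
    the power of the middle factor. *)
Lemma expr_qsgn n : q ^+ (n * n) = (- q) ^+ n * qsgn (q ^+ 2) n.
Proof.
elim: n => [|n IH]; first by rewrite /qsgn !expr0 !mul1r.
rewrite (_ : n.+1 * n.+1 = n * n + (2 * n + 1))%N; last by lia.
rewrite exprD [q ^+ (_ + 1)]exprD IH [q ^+ (2 *
  n)]exprM qsgnS [(- q) ^+ n.+1]exprS; move: (_ ^+ n) => P.
ring.
Qed.

Lemma wchi_Mn (m n : expo) a b : wchi hbar (m *+ a) (n *+ b) =
  wchi hbar m n ^+ (a * b).
Proof.
rewrite /wchi omegaMnl omegaMnr -mulrnA mulnC -CexpMn; congr Cexp.
by rewrite rmorphMn /= mulrnAr mulrnAl.
Qed.

Lemma wchiDl (m n k : expo) : wchi hbar (m + n) k =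
  wchi hbar m k * wchi hbar n k.
Proof.
rewrite /wchi omegaDl -CexpD rmorphD /=; congr Cexp; ring.
Qed.

Lemma wchiDr (m n k : expo) : wchi hbar k (m + n) =
  wchi hbar k m * wchi hbar k n.
Proof.
rewrite /wchi omegaDr -CexpD rmorphD /=; congr Cexp; ring.
Qed.

Lemma qdilog_comm (u w : linform R) :
  ffib (fun n => u.1 *+ n) -> ffib (fun n => w.1 *+ n) ->
  ffib (fun n : nat * nat => u.1 *+ n.1 + w.1 *+ n.2) ->
  omega u.1 w.1 = 0 ->
  fmul hbar (qdilog hbar (fexp u)) (qdilog hbar (fexp w)) =
  fmul hbar (qdilog hbar (fexp w)) (qdilog hbar (fexp u)).
Proof.
move=> fu fw fuw uw0; pose sw (n : nat * nat) := (n.2, n.1).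
have sw_bij : bijective sw by exists sw => -[].
have fwu : ffib (fun n : nat * nat => w.1 *+ n.1 + u.1 *+ n.2).
  move=> m; apply: sub_finite_set (finite_image sw (fuw m)) => -[a b] /= <-.
  by exists (b, a) => //=; rewrite addrC.
rewrite !fmulE !qdilogE !conv_push// -[LHS](push_reindex _ _ sw_bij).
have w10 : wchi hbar u.1 w.1 = 1 by rewrite /wchi uw0 mulr0 mul0r Cexp0.
have w01 : wchi hbar w.1 u.1 =
  1 by rewrite /wchi omegaC uw0 oppr0 mulr0 mul0r Cexp0.
apply: eq_push => -[a b] /=; first exact: addrC.
by rewrite !wchi_Mn w10 w01 !expr1n; ring.
Qed.

(* (i, j, k) are the powers of W, of the third monomial UW and of U in the
   right-hand side of the pentagon. *)
Lemma push_regroup (K : fieldType) (c : nat * nat * nat -> K) a b :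
  push (fun n : nat * nat * nat => ((n.1.2 + n.2)%N,
    (n.1.1 + n.1.2)%N)) c (a, b) =
  \sum_(j < a.+1 | (j <= b)%N) c ((b - j)%N, j : nat, (a - j)%N).
Proof.
rewrite big_mkcond /= (@fsbig_ord _ _ _ a.+1
  (fun j => if (j <= b)%N then c ((b - j)%N, j, (a - j)%N) else 0)).
transitivity (\sum_(j \in `I_a.+1 `&` [set j | (j <= b)%N]) c ((b - j)%N, j,
  (a - j)%N)).
  apply: (reindex_fsbig (fun j => ((b - j)%N, j, (a - j)%N))); split => /=.
  - by move=> j /= [? ?]; congr (_, _); lia.
  - by move=> j j' _ _ [].
  - by move=> [[i j] k] /= [<- <-]; exists j; [lia | congr (_, _, _); lia].
rewrite fsbig_mkcondr; apply: eq_fsbigr => j _.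
by rewrite mem_setE.
Qed.

(** The hypothesis says UW = q^2 WU. Both sides become families indexed by the powers (a, b) of U
    and W, whose coefficients agree by [qsum_pentagon]. *)
Lemma pentagon (u w : linform R) : omega u.1 w.1 = 2 ->
  fmul hbar (qdilog hbar (fexp u)) (qdilog hbar (fexp w)) =
  fmul hbar (fmul hbar (qdilog hbar (fexp w)) (qdilog hbar (fexp (u + w))))
            (qdilog hbar (fexp u)).
Proof.
move=> uw; have wu : omega w.1 u.1 = - 2 by rewrite omegaC uw.
have om_inj (a b : nat) : (2 : int) *+ a = 2 *+ b -> a = b.
  by move/eqP; rewrite -!mulrnA eqr_nat eqn_pmul2l// => /eqP.
(* Pairing with [w.1] recovers the first power, pairing with [u.1] the second. *)
have inj_lin : injective (fun n : nat * nat => u.1 *+ n.1 + w.1 *+ n.2).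
  move=> [a b] [a' b'] /= h; congr (_, _); apply: om_inj.
    have := congr1 (fun m => omega m w.1) h.
    by rewrite !omegaDl !omegaMnl uw omegaxx !mul0rn !addr0.
  have := congr1 (fun m => omega u.1 m) h.
  by rewrite !omegaDr !omegaMnr uw omegaxx !mul0rn !add0r.
have fu : ffib (fun n => u.1 *+ n).
  apply: ffib_inj => a b h; have [//] : (a, 0%N) = (b, 0%N).
  by apply: inj_lin; rewrite /= h.
have fw : ffib (fun n => w.1 *+ n).
  apply: ffib_inj => a b h; have [//] : (0%N, a) = (0%N, b).
  by apply: inj_lin; rewrite /= h.
have fs : ffib (fun n => (u + w).1 *+ n).
  apply: ffib_inj => a b h; have [//] : (a, a) = (b, b).
  by apply: inj_lin; rewrite /= -!mulrnDl.
have fws : ffib (fun n : nat * nat => w.1 *+ n.1 + (u + w).1 *+ n.2).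
  apply: ffib_inj => -[a b] [a' b']; rewrite /= !mulrnDl => h.
  have [-> /addnI -> //] : (b, (b + a)%N) = (b', (b' + a')%N).
  by apply: inj_lin; rewrite /= !mulrnDr [LHS]addrA [LHS]addrC h [RHS]addrA
    [RHS]addrC.
(* The total powers of U and of W in W^i (UW)^j U^k. *)
pose r (n : nat * nat * nat) := ((n.1.2 + n.2)%N, (n.1.1 + n.1.2)%N).
have linE : (fun n : nat * nat * nat => w.1 *+ n.1.1 + (u + w).1 *+ n.1.2 +
  u.1 *+ n.2) =
    (fun n : nat * nat => u.1 *+ n.1 + w.1 *+ n.2) \o r.
  apply/funext => -[[a b] c] /=; rewrite mulrnDl !mulrnDr.
  by rewrite [w.1 *+ a + _]addrCA addrAC.
have fr : ffib r.
  move=> [a b]; have := finite_setX (finite_setX (finite_II b.+1) (finite_II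
    b.+1)) (finite_II a.+1).
  by apply: sub_finite_set => -[[i j] k] /= [? ?]; lia.
rewrite !fmulE !qdilogE [in LHS]conv_push//; last exact: ffib_inj.
rewrite [X in _ = conv _ X _]conv_push// conv_push//; last first.
  by rewrite linE; apply: ffib_comp.
rewrite [in RHS]/= linE -push_comp; last by apply: ffib_comp.
apply: eq_push => // -[a b] /=; rewrite push_regroup /=.
have wuw : wchi hbar u.1 w.1 = q by rewrite /wchi uw mulfK// pnatr_eq0.
have wwu : wchi hbar w.1 u.1 = q^-1.
  by rewrite /wchi wu rmorphN /= mulrN mulNr mulfK ?pnatr_eq0// CexpN.
have wxx (v : expo) : wchi hbar v v =
  1 by rewrite /wchi omegaxx mulr0 mul0r Cexp0.
(* Writing q^(ab) as q^(-ab) q^(2ab) exposes the right-hand side of [qsum_pentagon]. *)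
transitivity (Cexp (u.2 *+ a) * Cexp (w.2 *+ b) * (- q) ^+ (a +
  b) * q^-1 ^+ (a * b) *
    ((q ^+ 2) ^+ (a * b) / qfac (q ^+ 2) a / qfac (q ^+ 2) b)).
  rewrite wchi_Mn wuw !dcoefE exprD.
  have -> : q ^+ (a * b) = q^-1 ^+ (a * b) * (q ^+ 2) ^+ (a * b).
    by rewrite -exprMn expr2 mulKf// Cexp_neq0.
  ring.
rewrite -(qsum_pentagon sqr_not_unity) mulr_sumr; apply: eq_bigr => j jb.
have ja : (j <= a)%N by rewrite -ltnS.
rewrite [wchi hbar (_ + _) (_ *+ _)]wchiDl !wchi_Mn.
rewrite [wchi hbar w.1 (_ + _)]wchiDr [wchi hbar (_ +
  _) u.1]wchiDl !wxx wwu mulr1 mul1r.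
rewrite !dcoefE.
have -> : Cexp (u.2 *+ a) = Cexp (u.2 *+ j) * Cexp (u.2 *+ (a - j)).
  by rewrite -CexpD -mulrnDr subnKC.
have -> : Cexp (w.2 *+ b) = Cexp (w.2 *+ j) * Cexp (w.2 *+ (b - j)).
  by rewrite -CexpD -mulrnDr subnKC.
rewrite mulrnDl CexpD.
(* The triple product has only a + b - j factors -q, and splitting ab leaves a surplus q^(-j^2);
   together with [qsgn] these discrepancies cancel. *)
have key : (- q) ^+ j * qsgn (q ^+ 2) j * q^-1 ^+ (j * j) = 1.
  by rewrite -expr_qsgn -exprMn divff ?expr1n ?Cexp_neq0.
have -> : (a + b = (b - j) + j + (a - j) + j)%N by lia.
have -> : (a * b = (b - j) * j + ((b - j) * (a - j) + j * (a - j)) + j * j)%N.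
  by rewrite -{1}(subnK ja) -{1}(subnK jb); lia.
rewrite -[RHS]mulr1 -key 6!exprD; ring.
Qed.

End Pentagon.

(** * Coefficients in Q(q) *)

Section RationalFunctions.
Variables (R : realType) (q : R[i]).
Local Notation ev f := ((map_poly ratr f).[q]).

Lemma evM f g : ev (f * g) = ev f * ev g.
Proof. by rewrite rmorphM hornerM. Qed.

Lemma evD f g : ev (f + g) = ev f + ev g.
Proof. by rewrite rmorphD hornerD. Qed.

Lemma Qq_poly (f : {poly rat}) : Qq q (ev f).
Proof. by exists f, 1; rewrite rmorph1 hornerC oner_neq0 invr1 mulr1. Qed.

Lemma Qq0 : Qq q 0.
Proof. by have := Qq_poly 0; rewrite rmorph0 hornerC. Qed.

Lemma Qq1 : Qq q 1.
Proof. by have := Qq_poly 1; rewrite rmorph1 hornerC. Qed.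

Lemma Qqq : Qq q q.
Proof. by have := Qq_poly 'X; rewrite map_polyX hornerX. Qed.

Lemma QqD x y : Qq q x -> Qq q y -> Qq q (x + y).
Proof.
move=> [f [g [g0 ->]]] [f' [g' [g0' ->]]]; exists (f * g' + f' * g), (g * g').
rewrite evD !evM; split; first exact: mulf_neq0.
by field; rewrite g0 g0'.
Qed.

Lemma QqN x : Qq q x -> Qq q (- x).
Proof.
move=> [f [g [g0 ->]]]; exists (- f), g; split => //.
by rewrite rmorphN /= hornerN mulNr.
Qed.

Lemma QqM x y : Qq q x -> Qq q y -> Qq q (x * y).
Proof.
move=> [f [g [g0 ->]]] [f' [g' [g0' ->]]]; exists (f * f'), (g * g').
rewrite !evM; split; first exact: mulf_neq0.
by rewrite mulf_div.
Qed.

Lemma QqV x : Qq q x -> Qq q x^-1.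
Proof.
have [->|x0] := eqVneq x 0; first by rewrite invr0.
move=> [f [g [g0 xE]]]; exists g, f; rewrite xE invf_div; split => //.
by apply: contraNneq x0; rewrite xE => ->; rewrite mul0r.
Qed.

Lemma QqX x n : Qq q x -> Qq q (x ^+ n).
Proof.
move=> qx; elim: n => [|n IH]; first by rewrite expr0; exact: Qq1.
by rewrite exprS; apply: QqM.
Qed.

Lemma Qq_exprz x (n : int) : Qq q x -> Qq q (x ^ n).
Proof. by move=> qx; case: n => n; [|apply: QqV]; apply: QqX. Qed.

Lemma Qq_sum (I : Type) (r : seq I) (P : pred I) (F : I -> R[i]) :
  (forall i, P i -> Qq q (F i)) -> Qq q (\sum_(i <- r | P i) F i).
Proof. by move=> h; apply: big_ind => //; [exact: Qq0 | exact: QqD]. Qed.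

Lemma Qq_prod (I : Type) (r : seq I) (P : pred I) (F : I -> R[i]) :
  (forall i, P i -> Qq q (F i)) -> Qq q (\prod_(i <- r | P i) F i).
Proof. by move=> h; apply: big_ind => //; [exact: Qq1 | exact: QqM]. Qed.

Lemma Qq_qfac n : Qq q (qfac (q ^+ 2) n).
Proof.
apply: Qq_prod => k _; apply: QqD; first exact: Qq1.
by apply/QqN/QqM; do ?apply: QqX; exact: Qqq.
Qed.

Lemma Qq_dcoef n : Qq q (dcoef q n).
Proof. by apply: QqM; [apply/QqX/QqN/Qqq | apply/QqV/Qq_qfac]. Qed.

Lemma Qq_qsgn n : Qq q (qsgn (q ^+ 2) n).
Proof. by apply: QqM; apply: QqX; [apply/QqN/Qq1 | apply/QqX/Qqq]. Qed.

Lemma Ahat_ymul f g : Ahat q f -> Ahat q g -> Ahat q (ymul q f g).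
Proof.
move=> qf qg k; apply: Qq_sum => kl _; apply: QqM; first exact: QqM.
by apply: Qq_exprz; exact: Qqq.
Qed.

End RationalFunctions.

(** * Dilogarithms as units of the completed algebra *)

Section Units.
Variables (R : realType) (hbar : R[i]) (lam : 'I_6 -> R[i]).
Local Notation q := (Cexp hbar).
Local Notation phi := (phi hbar lam).

Lemma Ahat_unit_ymul f g : Ahat_unit q f -> Ahat_unit q g ->
  Ahat_unit q (ymul q f g).
Proof.
have q0 : q != 0 := Cexp_neq0 _.
move=> [qf [f' [qf' [ff' f'f]]]] [qg [g' [qg' [gg' g'g]]]].
split; first exact: Ahat_ymul.
exists (ymul q g' f'); split; first exact: Ahat_ymul.
split.
  by rewrite (ymulA q0) -(ymulA q0 f) gg' ymul1.
by rewrite (ymulA q0) -(ymulA q0 g') f'f ymul1.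
Qed.

Lemma What_unit_fmul F G : What_unit hbar lam F -> What_unit hbar lam G ->
  What_unit hbar lam (fmul hbar F G).
Proof.
move=> [f uf <-] [g ug <-]; exists (ymul q f g); last exact: phiM.
exact: Ahat_unit_ymul.
Qed.

Lemma What_fmulA F G H : What_unit hbar lam F -> What_unit hbar lam G ->
  What_unit hbar lam H ->
  fmul hbar F (fmul hbar G H) = fmul hbar (fmul hbar F G) H.
Proof.
move=> [f _ <-] [g _ <-] [h _ <-].
by rewrite -!phiM ymulA// Cexp_neq0.
Qed.

(** Its exponential is Y^k in Weyl normalisation, that is, without the power of q caused by ordering
    the factors. *)
Definition yform_sum (k : yexpo) : linform R := \sum_i yform lam i *+ k i.

Lemma yform_sum_fst k : (yform_sum k).1 = yexp_sum k.
Proof.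
rewrite /yform_sum linform_fst_sum; apply: eq_bigr => i _.
by rewrite linform_fstMn.
Qed.

Lemma yexp_sum_mulrn k n : yexp_sum (k *+ n) = yexp_sum k *+ n.
Proof.
elim: n => [|n IH]; first by rewrite /yexp_sum big1// => i _; rewrite ffunE.
by rewrite !mulrS yexp_sumD IH.
Qed.

Lemma yform_sum_mulrn k n : yform_sum (k *+ n) = yform_sum k *+ n.
Proof.
by rewrite /yform_sum -sumrMnl; apply: eq_bigr => i _;
  rewrite yexpo_mulrnE mulrnA.
Qed.

Lemma yquad_mulrn k n : yquad (k *+ n) = yquad k *+ (n * n).
Proof.
rewrite /yquad -sumrMnl; apply: eq_bigr => i _; rewrite -sumrMnl.
by apply: eq_bigr => j _; rewrite !yexpo_mulrnE -mulrnA; congr (_ *+ _); lia.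
Qed.

(** This is [yquadD] at k = l, where [yquad] of 2k is four times [yquad k]. *)
Lemma bform_diag k : bform k k = - yquad k.
Proof.
have := yquadD k k; rewrite omegaxx -[k + k]/(k *+ 2) yquad_mulrn.
lia.
Qed.

Hypothesis q1 : forall n, (0 < n)%N -> q ^+ n != 1.

Lemma ffib_nat_add : ffib (fun n : nat * nat => (n.1 + n.2)%N).
Proof.
move=> m; have := finite_setX (finite_II m.+1) (finite_II m.+1).
by apply: sub_finite_set => -[a b] /= ?; split; rewrite /=; lia.
Qed.

Lemma push_nat_add (K : fieldType) (c : nat * nat -> K) m :
  push (fun n : nat * nat => (n.1 + n.2)%N) c m = \sum_(j < m.+1) c (j : nat,
    (m - j)%N).
Proof.
rewrite (@fsbig_ord _ _ _ m.+1 (fun j => c (j, (m - j)%N))).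
apply: (reindex_fsbig (fun j => (j, (m - j)%N))); split => /=.
- by move=> j /= ?; lia.
- by move=> j j' _ _ [].
- by move=> [i j] /= <-; exists i; [rewrite /=; lia | congr (_, _); lia].
Qed.

(* The normalisation q^(- w n^2) turns the n-th power of the Weyl-ordered
   exponential into the ordered monomial Y^(n k). *)
Lemma ray_inv k (a b : nat -> R[i]) w : k != 0 -> yquad k = w *+ 2 ->
  (forall n, \sum_(j < n.+1) a j * b (n - j)%N = (n == 0%N)%:R) ->
  ymul q (push (fun n => k *+ n) (fun n => a n * q ^ (- (w *+ (n * n)))))
         (push (fun n => k *+ n) (fun n => b n * q ^ (- (w *+ (n * n))))) =
           @yone R.
Proof.
move=> k0 kw ab; have q0 : q != 0 := Cexp_neq0 _.
have kinj := yexpo_mulrn_inj k0.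
have fk : ffib (fun n => k *+ n) by exact: ffib_inj.
have kadd : (fun n : nat * nat => k *+ n.1 + k *+ n.2) = (fun n =>
  k *+ n) \o (fun n => (n.1 + n.2)%N).
  by apply/funext => n /=; rewrite mulrnDr.
have fkk : ffib (fun n : nat * nat => k *+ n.1 + k *+ n.2).
  by rewrite kadd; apply: ffib_comp => //; exact: ffib_nat_add.
rewrite ymulE conv_push// kadd -push_comp -?kadd//.
pose s (_ : unit) := 0%N.
have -> : @yone R = push (fun n => k *+ n) (push s (fun=> 1)).
  by rewrite push_comp ?yone_push; [|exact: (@ffib_fin unit)].
congr push; apply/funext => n; rewrite push_nat_add /=.
transitivity ((\sum_(j < n.+1) a j * b (n - j)%N) * q ^ (- (w *+ (n * n)))).
  rewrite mulr_suml; apply: eq_bigr => j _.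
  rewrite /ychi bformMnl bformMnr bform_diag kw.
  have -> : - (w *+ (n * n)) = - (w *+ (j * j)) - (w *+ ((n - j) *
    (n - j))) + (- (w *+ 2)) *+ (n - j) *+ j.
    have jn : (j <= n)%N by rewrite -ltnS.
    have -> : (n * n = j * j + (n - j) * (n - j) + 2 * (n - j) * j)%N by nia.
    by rewrite !mulrnDr !mulrnA !mulNrn !opprD.
  by rewrite !expfzDr//; ring.
rewrite ab /push; case: n => [|n] /=.
  rewrite muln0 mulr0n oppr0 expr0z mulr1 (_ : _ @^-1` _ =
    [set tt]) ?fsbig_set1//.
  by apply/seteqP; split => -[].
by rewrite mul0r fsbig1.
Qed.

(** Evenness of [yquad k] makes the passage from Weyl-normalised powers to ordered monomials an
    integral power of q, so the coefficients stay in Q(q). *)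
Lemma qdilog_unit k w : k != 0 -> yquad k = w *+ 2 ->
  What_unit hbar lam (qdilog hbar (fexp (yform_sum k))).
Proof.
move=> k0 kw; have q0 : q != 0 := Cexp_neq0 _.
have p1 := sqr_not_unity q1.
(* Coefficients of (-qU; q^2)_oo, the inverse of the dilogarithm. *)
pose ic n := dcoef q n * qsgn (q ^+ 2) n.
exists (push (fun n => k *+ n) (fun n => dcoef q n * q ^ (- (w *+ (n *
  n))))); last first.
  rewrite phiE push_mulr push_comp.
    rewrite qdilogE; apply: eq_push => n /=.
      by rewrite yexp_sum_mulrn yform_sum_fst.
    rewrite /ycoef -/(yform_sum _) yform_sum_mulrn linform_sndMn yquad_mulrn
      kw -mulrA
      CexpD.
    have -> : hbar * ((w *+ 2 *+ (n * n))%:~R / 2%:R) =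
      hbar * (w *+ (n * n))%:~R.
      rewrite mulrnAC [(w *+ _ *+ 2)%:~R]rmorphMn /= -[_%:~R *+ 2]mulr_natr
        mulfK//.
      by rewrite pnatr_eq0.
    rewrite Cexp_int mulrCA [in RHS]mulrC; congr (_ * _).
    by rewrite -mulrA -expfzDr// addNr expr0z mulr1.
  apply: ffib_comp; last exact: yexp_sum_inj.
  exact/ffib_inj/yexpo_mulrn_inj.
have fin_push (c : nat -> R[i]) : (forall n, Qq q (c n)) ->
  Ahat q (push (fun n => k *+ n) c).
  by move=> qc m; apply: Qq_sum => j _.
have hq n : Qq q (q ^ (- (w *+ (n * n)))) by apply/Qq_exprz/Qqq.
split; first by apply: fin_push => n; apply: QqM => //; exact: Qq_dcoef.
exists (push (fun n => k *+ n) (fun n => ic n * q ^ (- (w *+ (n * n))))); split.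
  apply: fin_push => n; apply: QqM => //; apply: QqM;
    [exact: Qq_dcoef|exact: Qq_qsgn].
have inv2 n : \sum_(j < n.+1) ic j * dcoef q (n - j) = (n == 0%N)%:R.
  transitivity ((- q) ^+ n * (n == 0%N)%:R); last first.
    by case: n => [|n]; rewrite ?expr0 ?mul1r// mulr0.
  rewrite -(qsum_inv p1) mulr_sumr; apply: eq_bigr => j _.
  have jn : (j <= n)%N by rewrite -ltnS.
  have -> : (- q) ^+ n = (- q) ^+ (n - j) * (- q) ^+ j by rewrite -exprD subnK.
  rewrite /ic !dcoefE; ring.
have inv1 n : \sum_(j < n.+1) dcoef q j * ic (n - j)%N = (n == 0%N)%:R.
  rewrite -inv2 (reindex_inj rev_ord_inj) /=; apply: eq_bigr => j _.
  by rewrite subSS subKn; [exact: mulrC | rewrite -ltnS].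
by split; apply: ray_inv.
Qed.

End Units.

(** * The tetrahedron equation in N(A_3) *)

Section NA3.
Variable R : realType.
Local Notation G := (NA3 R).
Local Open Scope quotient_scope.
Implicit Types (a b c d : 'I_6) (x y z : G).

(** The empty word for a = b, the same convention as in [epu]; [Tpu] is thus total. *)
Definition puw a b (s : bool) : word R :=
  if @idP (a != b) is ReflectT h then [:: EXP (GPU R h s)] else [::].

Definition Tpu a b : G := \pi_(NA3 R) (puw a b false).
Definition Uu (k : R[i]) a : G := \pi_(NA3 R) [:: EXP (GU a k)].

Lemma pi_cat w w' : (\pi_(NA3 R) w * \pi_(NA3 R) w')%g = \pi_(NA3 R) (w ++ w').
Proof. exact: mulN_pi. Qed.

Lemma pi_cat3 w1 w2 w3 : (\pi_(NA3 R) w1 * (\pi_(NA3 R) w2 *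
  \pi_(NA3 R) w3))%g =
  \pi_(NA3 R) (w1 ++ (w2 ++ w3)).
Proof. by rewrite [X in (_ * X)%g]pi_cat pi_cat. Qed.

Lemma pi_inv w : (\pi_(NA3 R) w)^-1%g = \pi_(NA3 R) (inv_word w).
Proof. exact: invN_pi. Qed.

Lemma puwE a b s (h : a != b) : puw a b s = [:: EXP (GPU R h s)].
Proof. by rewrite /puw; case: {-}_ / idP => // h';
  rewrite (bool_irrelevance h' h). Qed.

Lemma puwxx a s : puw a a s = [::].
Proof. by rewrite /puw; case: {-}_ / idP => // h; have := h; rewrite eqxx. Qed.

Lemma Tpuxx a : Tpu a a = 1%g.
Proof. by rewrite /Tpu puwxx. Qed.

Lemma TpuV a b : (Tpu a b)^-1%g = \pi_(NA3 R) (puw a b true).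
Proof.
rewrite pi_inv; have [<-|ab] := eqVneq a b; first by rewrite !puwxx.
by rewrite !(puwE _ ab).
Qed.

Lemma Tpu_comm a b c d : a != d -> b != c ->
  (Tpu a b * Tpu c d = Tpu c d * Tpu a b)%g.
Proof.
move=> ad bc; have [->|ab] := eqVneq a b; first by rewrite Tpuxx mul1g mulg1.
have [->|cd] := eqVneq c d; first by rewrite Tpuxx mul1g mulg1.
rewrite !pi_cat (puwE _ ab) (puwE _ cd); apply/NA3_eqP; apply: bch_comm0.
rewrite /bracket /= expr0 !scale1r /mxC !mul0mx subrr.
by rewrite !mul_delta_mx_0 ?subrr // eq_sym.
Qed.

Lemma Tpu_braid a b c : a != b -> b != c -> a != c ->
  (Tpu b c * Tpu a b = Tpu a c * (Tpu a b * Tpu b c))%g.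
Proof.
move=> ab bc ac.
(* The bracket of p_a u_b and p_b u_c is -hbar^(-1) p_a u_c after scaling, so [bch_comm] produces
   the inverse of [Tpu a c]. *)
suff -> : (Tpu a b * Tpu b c = (Tpu a c)^-1 * (Tpu b c * Tpu a b))%g.
  by rewrite mulKVg.
rewrite TpuV pi_cat3 pi_cat !(puwE _ ab) !(puwE _ bc) (puwE _ ac);
  apply/NA3_eqP.
have lg k l (h : k != l) s : log (GPU R h s) = ((-1) ^+ s *: delta_mx k l,
  0) by [].
have br k l k' l' e e' : bracket (R := R) (e *: delta_mx k l,
  0) (e' *: delta_mx k' l', 0) =
    ((e * e') *: (delta_mx k' l' *m delta_mx k l - delta_mx k l *m delta_mx k'
      l'), 0).
  rewrite /bracket /= !mul0mx subrr scalerBr -!scalemxAl -!scalemxAr !scalerA.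
  by rewrite [e' * e]mulrC.
have ne (i j : 'I_6) : i != j -> (j == i) = false by rewrite eq_sym => /negPf.
apply: bch_comm; rewrite !lg br ?mul_delta_mx_cond ?eqxx ?(ne _ _ ab) ?(ne _ _
  bc) ?(ne _ _ ac)
  ?(negPf ab) ?(negPf bc) ?(negPf ac).
- by rewrite /= !mulr0n mulr1n sub0r scalerN -scaleNr !expr0 mulr1.
- by rewrite /= !mulr0n subrr scaler0.
- by rewrite /= !mulr0n subrr scaler0.
Qed.

Lemma Tpu_Uu a b (k : R[i]) : a != b ->
  (Tpu a b * Uu k a = Uu k b * (Uu k a * Tpu a b))%g.
Proof.
move=> ab; rewrite pi_cat3 pi_cat (puwE _ ab); apply/NA3_eqP.
have dC : mxC R (delta_mx a b) = delta_mx a b by rewrite /mxC map_delta_mx.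
have dN : mxC R 0 = 0 :> 'M[R[i]]_6 by rewrite /mxC map_mx0.
by apply: bch_comm; rewrite /bracket /= ?expr0 ?scale1r ?dC ?dN ?mulmx0 ?mul0mx
  -?scalemxAl ?mul_delta_mx ?mul_delta_mx_0 ?scaler0 ?subrr ?subr0 // eq_sym.
Qed.

Lemma Tpu_UuC a b d (k : R[i]) : a != d ->
  (Tpu a b * Uu k d = Uu k d * Tpu a b)%g.
Proof.
move=> ad; have [->|ab] := eqVneq a b; first by rewrite Tpuxx mul1g mulg1.
rewrite !pi_cat (puwE _ ab); apply/NA3_eqP; apply: bch_comm0.
rewrite /bracket /= expr0 scale1r mulmx0 mul0mx subrr /mxC map_delta_mx map_mx0
  mul0mx subr0.
by rewrite -scalemxAl mul_delta_mx_0 ?scaler0// eq_sym.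
Qed.

Lemma UuC a b (k l : R[i]) : (Uu k a * Uu l b = Uu l b * Uu k a)%g.
Proof.
rewrite !pi_cat; apply/NA3_eqP; apply: bch_comm0.
by rewrite /bracket /= /mxC map_mx0 !mulmx0 !subrr.
Qed.

Lemma UuD a (k l : R[i]) : (Uu k a * Uu l a = Uu (k + l) a)%g.
Proof.
rewrite !pi_cat; apply/NA3_eqP; apply: bch_add.
  by rewrite /bracket /= /mxC map_mx0 !mulmx0 !subrr.
by rewrite /= -[LHS]/((0 : 'M_6) + 0, _ + _) addr0 -scalerDl.
Qed.

Lemma Uu0 a : Uu 0 a = 1%g.
Proof. by apply/NA3_eqP; apply: bch_exp0; rewrite /= scale0r. Qed.

Lemma UuN a (k : R[i]) : (Uu k a)^-1%g = Uu (- k) a.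
Proof. by rewrite pi_inv. Qed.

Lemma permN_Tpu (s : 'S_6) a b : permN s (Tpu a b) = Tpu (s a) (s b).
Proof.
rewrite permN_pi; congr (\pi_ _ _); have [->|ab] := eqVneq a b.
  by rewrite !puwxx.
have sab : s a != s b by rewrite (inj_eq perm_inj).
by rewrite (puwE _ ab) (puwE _ sab) /=; congr [:: EXP _]; apply: GPU_eq.
Qed.

Lemma permN_Uu (s : 'S_6) a (k : R[i]) : permN s (Uu k a) = Uu k (s a).
Proof. exact: permN_pi. Qed.

Lemma permN_mulg (s : 'S_6) x y : permN s (x * y)%g = (permN s x * permN s y)%g.
Proof. exact: permN_mul. Qed.

Lemma permN_inv (s : 'S_6) x : permN s (x^-1)%g = ((permN s x)^-1)%g.
Proof.
apply: (mulgI (permN s x)); rewrite -permN_mulg !mulgV.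
exact: permN_one.
Qed.

Definition Uvec (v : 'I_6 -> R[i]) : G := (\prod_(i < 6) Uu (v i) i)%g.

Lemma UvecM v w : (Uvec v * Uvec w = Uvec (fun i => v i + w i))%g.
Proof.
rewrite /Uvec -prodgM_commute.
  by apply: eq_bigr => i _; rewrite UuD.
by move=> i j _ _; exact: UuC.
Qed.

Lemma prod_pred1 a x : (\prod_(i < 6) (if i == a then x else 1) = x :> G)%g.
Proof. by rewrite -big_mkcond big_pred1_eq. Qed.

Lemma Uu_Uvec a (k : R[i]) : Uu k a = Uvec (fun i => if i == a then k else 0).
Proof.
rewrite -[LHS](prod_pred1 a); apply: eq_bigr => i _.
by case: eqP => [->|]; rewrite ?Uu0.
Qed.

(** Conjugation by [Tpu a b] is multiplicative, so it is determined by the factors of [Uvec v]. Only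
    the factor at a moves, and it creates a copy of itself at b: a shear. *)
Lemma Tpu_Uvec a b v : a != b -> (Tpu a b * Uvec v =
  Uvec (fun i => v i + (if i == b then v a else 0)) * Tpu a b)%g.
Proof.
move=> ab; rewrite -UvecM -Uu_Uvec.
pose cj x := (Tpu a b * x * (Tpu a b)^-1)%g.
suff : cj (Uvec v) = (Uvec v * Uu (v a) b)%g by rewrite /cj => <-;
  rewrite mulgKV.
rewrite -[Uu _ _](prod_pred1 a) /Uvec -prodgM_commute; last first.
  by move=> i j _ _; case: eqP => _; [exact: UuC | exact: commute1].
rewrite (big_morph cj (id1 := 1%g) (op1 := fun x y => (x * y)%g)).
- apply: eq_bigr => i _; case: eqP => [->|/eqP ia]; rewrite /cj.
    by rewrite Tpu_Uu// UuC mulgA mulgK UuC.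
  by rewrite Tpu_UuC 1?eq_sym// mulgK mulg1.
- by move=> x y; rewrite /cj !mulgA mulgKV.
- by rewrite /cj mulg1 mulgV.
Qed.

Lemma TpuV_Uvec a b v : a != b -> ((Tpu a b)^-1 * Uvec v =
  Uvec (fun i => v i - (if i == b then v a else 0)) * (Tpu a b)^-1)%g.
Proof.
move=> ab; apply: (mulgI (Tpu a b));
  rewrite mulKVg mulgA Tpu_Uvec// -mulgA mulgV mulg1.
congr Uvec; apply/funext => i; rewrite (negPf ab) subr0.
by rewrite subrK.
Qed.

End NA3.

(** * The tetrahedron equation for P_ijk *)

Section Tetrahedron.
Variable R : realType.
Local Notation G := (NA3 R).
Local Open Scope quotient_scope.

Lemma mulNSE (x y : NA3 R) (s t : 'S_6) :
  (((x, s) : NS6 R) * (y, t))%g = ((x * permN s y)%g, (t * s)%g).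
Proof. by []. Qed.

Lemma invNSE (x : NA3 R) : (((x, 1%g) : NS6 R)^-1)%g = ((x^-1)%g, 1%g) :> NS6 R.
Proof. by rewrite -[LHS]/(permN 1^-1%g (invN x), 1^-1%g) invg1 permN_1. Qed.

Lemma epuE i j : epu R i j = (Tpu R i j, 1%g).
Proof. by rewrite /epu /Tpu /puw; case: {-}_ / idP. Qed.

Lemma rhoE i j : rho R i j = (1%g, tperm i j). Proof. by []. Qed.

Lemma euE (c : R[i]) i : eu c i = (Uu c i, 1%g).
Proof. by []. Qed.

(* P_ijk = Pn i j k (lambda_j - lambda_k) rho_jk. *)
Definition Pn (i j k : 'I_6) (c : R[i]) : G :=
  (Tpu R i j * (Tpu R i k)^-1 * (Uu c j * Uu (- c) i))%g.

(** Moving rho_jk to the right exchanges j and k; hence [Tpu] for (i, j) occurs positively in [Pn],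
    although u_j has a minus sign in P_ijk. *)
Lemma PopE lam i j k : ix i != ix j -> ix i != ix k ->
  Pop lam i j k = (Pn (ix i) (ix j) (ix k) (lam (ix j) - lam (ix k)),
    tperm (ix j) (ix k)) :> NS6 R.
Proof.
move=> ij ik; rewrite /Pop !epuE !euE rhoE !invNSE !mulNSE !permN_1 !mul1g.
rewrite UuN !permN_mulg !permN_inv !permN_Tpu !permN_Uu.
by rewrite /= [mulN _ _]mul1N tpermL tpermR tpermD // eq_sym.
Qed.

Lemma permN_Pn s i j k c : permN s (Pn i j k c) = Pn (s i) (s j) (s k) c.
Proof. by rewrite /Pn !permN_mulg permN_inv !permN_Tpu !permN_Uu. Qed.

Lemma ixE n : (0 < n <= 6)%N -> ix n = n.-1 :> nat.
Proof. by case: n => // n hn; rewrite inordK. Qed.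

Lemma ix_neq m n : (0 < m <= 6)%N -> (0 < n <= 6)%N -> m != n -> ix m != ix n.
Proof.
move=> hm hn mn; rewrite -val_eqE /= !ixE//.
by case: m n hm hn mn => [|m] [|n].
Qed.

Lemma Tpu_commV a b c d : a != d -> b != c ->
  [/\ commute (Tpu R a b) (Tpu R c d), commute (Tpu R a b)^-1 (Tpu R c d),
     commute (Tpu R a b) (Tpu R c d)^-1 & commute (Tpu R a b)^-1 (Tpu R c
       d)^-1]%g.
Proof.
move=> ad bc; have h : commute (Tpu R a b) (Tpu R c d) := Tpu_comm _ ad bc.
have hV := commuteV h; split => //.
  exact/commute_sym/commuteV/commute_sym.
exact/commute_sym/commuteV/commute_sym.
Qed.

(** Since z commutes with x and y, the commutator relation passes to inverses, the sign of z being
    the product of the signs of x and y. *)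
Lemma Tpu_braidV a b c : a != b -> b != c -> a != c ->
  let x := Tpu R a b in let y := Tpu R b c in let z := Tpu R a c in
  [/\ y * x = z * (x * y), y^-1 * x = z^-1 * (x * y^-1),
      y * x^-1 = z^-1 * (x^-1 * y) & y^-1 * x^-1 = z * (x^-1 * y^-1)]%g.
Proof.
move=> ab bc ac x y z; have yx : (y * x = z * (x *
  y))%g := Tpu_braid _ ab bc ac.
have [zx zVx zxV zVxV] : [/\ commute z x, commute z^-1 x,
  commute z x^-1 & commute z^-1 x^-1]%g.
  by apply: Tpu_commV; rewrite // eq_sym.
have [zy zVy zyV zVyV] : [/\ commute z y, commute z^-1 y,
  commute z y^-1 & commute z^-1 y^-1]%g.
  by apply: Tpu_commV; rewrite // eq_sym.
have yVx : (y^-1 * x = z^-1 * (x * y^-1))%g.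
  apply: (mulgI y); rewrite mulKVg mulgA -zVy -!mulgA [(y * _)%g]mulgA yx.
  by rewrite -!mulgA mulgV mulg1 mulKg.
have yxV : (y * x^-1 = z^-1 * (x^-1 * y))%g.
  apply: (mulIg x); rewrite -!mulgA mulVg mulg1 yx.
  by rewrite [(x^-1 * (z * _))%g]mulgA -zxV -mulgA mulKg mulKg.
split => //.
apply: (mulgI y); rewrite mulKVg mulgA -zy -!mulgA [(y * (x^-1 *
  _))%g]mulgA yxV.
by rewrite -!mulgA mulgV mulg1 mulKVg.
Qed.

Lemma commute_mul4 (H : groupType) (x x' y y' : H) :
  commute x y -> commute x y' -> commute x' y -> commute x' y' ->
  commute (x * x')%g (y * y')%g.
Proof.
by move=> *; apply: commuteM; apply: commute_sym; apply: commuteM;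
  apply: commute_sym.
Qed.

(** Z is pushed to the right of W and later brought back to meet the Z^-1 created by moving X past
    W; V crosses X and W freely. *)
Lemma tetrahedron_group (H : groupType) (X Y Z W V : H) :
  commute Z X -> commute Z Y -> commute Z W -> commute V X -> commute V W ->
  (Y * W = V * (W * Y))%g -> (X * W = Z^-1 * (W * X))%g ->
  (X * Y * Z * W = W * V * X * Y)%g.
Proof.
rewrite /commute => ZX ZY ZW VX VW YW XW.
rewrite -mulgA ZW -!mulgA [(Y * (W * _))%g]mulgA YW -!mulgA -ZY.
rewrite [(X * (V * _))%g]mulgA -VX -mulgA [(X * (W * _))%g]mulgA XW -!mulgA.
rewrite [(X * (Z * _))%g]mulgA -ZX -mulgA [(W * (Z *
  _))%g]mulgA -ZW -mulgA mulKg.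
by rewrite mulgA VW -mulgA.
Qed.

Lemma braid_mul (H : groupType) (a b c e f : H) :
  (a * c = e * (c * a))%g -> (b * c = f * (c * b))%g -> commute f a ->
    commute e f ->
  (a * b * c = e * f * (c * (a * b)))%g.
Proof.
rewrite /commute => ac bc fa ef.
by rewrite -mulgA bc mulgA -fa -mulgA [(a * (c * _))%g]mulgA ac ef -!mulgA.
Qed.

Local Notation t a b := (Tpu R (ix a%N) (ix b%N)).

Lemma Tpu_tetrahedron :
  (t 4 5 * (t 4 6)^-1 * (t 2 3 * (t 2 5)^-1) *
    (t 1 5 * (t 1 6)^-1) * (t 1 2 * (t 1 4)^-1) =
   t 1 2 * (t 1 4)^-1 * (t 1 3 * (t 1 5)^-1) *
    (t 4 5 * (t 4 6)^-1) * (t 2 3 * (t 2 5)^-1))%g.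
Proof.
have c1 a b c d : all (fun n => 0 < n <= 6)%N [:: a; b; c; d] ->
    [&& a != d & b != c] ->
    [/\ commute (t a b) (t c d), commute (t a b)^-1 (t c d),
      commute (t a b) (t c d)^-1 & commute (t a b)^-1 (t c d)^-1]%g.
  rewrite /= andbT => /and4P[ha hb hc hd] /andP[ad bc].
  exact: Tpu_commV (ix_neq ha hd ad) (ix_neq hb hc bc).
have cc a b b' c d d' : all (fun n => 0 < n <= 6)%N [:: a; b; b'; c; d; d'] ->
    [&& a != d, a != d', b != c & b' != c] ->
    commute (t a b * (t a b')^-1)%g (t c d * (t c d')^-1)%g.
  rewrite /= andbT => /and5P[ha hb hb' hc /andP[hd hd']] /and4P[ad ad' bc b'c].
  have [h1 _ h2 _] := Tpu_commV (ix_neq ha hd ad) (ix_neq hb hc bc).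
  have [_ _ h2' _] := Tpu_commV (ix_neq ha hd' ad') (ix_neq hb hc bc).
  have [_ h3 _ _] := Tpu_commV (ix_neq ha hd ad) (ix_neq hb' hc b'c).
  have [_ _ _ h4] := Tpu_commV (ix_neq ha hd' ad') (ix_neq hb' hc b'c).
  exact: commute_mul4.
have br a b c : all (fun n => 0 < n <= 6)%N [:: a; b; c] ->
    [&& a != b, b != c & a != c] ->
    [/\ t b c * t a b = t a c * (t a b * t b c),
      (t b c)^-1 * t a b = (t a c)^-1 * (t a b * (t b c)^-1),
      t b c * (t a b)^-1 = (t a c)^-1 * ((t a b)^-1 * t b c) &
      (t b c)^-1 * (t a b)^-1 = t a c * ((t a b)^-1 * (t b c)^-1)]%g.
  rewrite /= andbT => /and3P[ha hb hc] /and3P[ab bc ac].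
  by apply: Tpu_braidV; apply: ix_neq.
set X := (t 4 5 * _)%g; set Y := (t 2 3 * _)%g.
set Z := (t 1 5 * _)%g; set W := (t 1 2 * _)%g; set V := (t 1 3 * _)%g.
have cZX : commute Z X by apply: cc.
have cZY : commute Z Y by apply: cc.
have cZW : commute Z W by apply: cc.
have cVX : commute V X by apply: cc.
have cVW : commute V W by apply: cc.
(* Passing T_23 and T_25^-1 over T_12 creates T_13 and T_15^-1, which form V; T_14 commutes with
   both. *)
have YW : (Y * W = V * (W * Y))%g.
  have [b1 _ _ _] := br 1 2 3 isT isT; have [_ b2 _ _] := br 1 2 5 isT isT.
  have [_ k1 _ _] := c1 1 5 2 3 isT isT; have [_ _ k2 _] := c1 1 3 1 5 isT isT.
  have [_ k3 _ _] := c1 1 4 2 3 isT isT; have [_ _ _ k4] := c1 1 4 2 5 isT isT.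
  rewrite mulgA (braid_mul b1 b2 k1 k2) -!mulgA; congr (_ * (_ * (_ * _)))%g.
  by rewrite mulgA -(commuteM k3 k4).
(* X commutes with T_12; passing T_45 and T_46^-1 over T_14^-1 creates T_15^-1 and T_16, which form
   Z^-1. *)
have XW : (X * W = Z^-1 * (W * X))%g.
  have [_ _ b1 _] := br 1 4 5 isT isT; have [_ _ _ b2] := br 1 4 6 isT isT.
  have [k1 _ _ _] := c1 1 6 4 5 isT isT; have [_ k2 _ _] := c1 1 5 1 6 isT isT.
  have XT : commute X (t 1 2).
    have [h1 _ _ _] := c1 1 2 4 5 isT isT;
      have [_ _ h2 _] := c1 1 2 4 6 isT isT.
    exact/commute_sym/commuteM.
  have ZT : commute (t 1 2) Z.
    have [h1 _ _ _] := c1 1 2 1 5 isT isT;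
      have [_ _ h2 _] := c1 1 2 1 6 isT isT.
    exact: commuteM.
  rewrite mulgA XT -mulgA (braid_mul b1 b2 k1 k2) !mulgA;
    congr (_ * _ * _ * _)%g.
  rewrite -/X -mulgA k2 -[t 1 6]invgK -invMg -/Z.
  exact: commuteV.
exact: tetrahedron_group.
Qed.

Local Notation Pl a b c k := (Pn (ix a%N) (ix b%N) (ix c%N) k).

(** With vectors given as lists, shears become [set_nth] and evaluate by simplification. *)
Definition Useq (v : seq R[i]) : G := Uvec (fun i : 'I_6 => v`_i).

Lemma Pn_Useq a b c k : all (fun n => 0 < n <= 6)%N [:: a; b] ->
  Pl a b c k = (t a b * ((t a c)^-1 *
    Useq (mkseq (fun n => (if n.+1 == b then k else 0) - (if n.+1 == a then k
      else 0)) 6)))%g.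
Proof.
move=> /= /and3P[ha hb _]; rewrite /Pn !Uu_Uvec UvecM -mulgA;
  congr (_ * (_ * Uvec _))%g.
apply/funext => i; rewrite nth_mkseq// -!val_eqE /= !ixE//.
case: a b ha hb => [//|a] [//|b] _ _ /=; rewrite !eqSS.
by case: (i == a :> nat); rewrite ?oppr0.
Qed.

Lemma Useq_mulA v w x : size v = 6 -> size w = 6 ->
  (Useq v * (Useq w * x) = Useq [seq p.1 + p.2 | p <- zip v w] * x)%g.
Proof.
move=> sv sw; rewrite mulgA UvecM; congr (Uvec _ * _)%g; apply/funext => i.
by rewrite (nth_map (0, 0)) ?nth_zip//= ?size_zip ?sv ?sw// minnn.
Qed.

Lemma Tpu_UseqA a b v x : all (fun n => 0 < n <= 6)%N [:: a; b] -> a != b ->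
  (t a b * (Useq v * x) = Useq (set_nth 0 v b.-1 (v`_b.-1 +
    v`_a.-1)) * (t a b * x))%g.
Proof.
move=> /= /and3P[ha hb _] ab; rewrite !mulgA Tpu_Uvec ?ix_neq//.
congr (Uvec _ * _ * _)%g; apply/funext => i.
rewrite nth_set_nth /= -val_eqE /= !ixE//.
by case: eqP => [->//|]; rewrite addr0.
Qed.

Lemma TpuV_UseqA a b v x : all (fun n => 0 < n <= 6)%N [:: a; b] -> a != b ->
  ((t a b)^-1 * (Useq v * x) =
   Useq (set_nth 0 v b.-1 (v`_b.-1 - v`_a.-1)) * ((t a b)^-1 * x))%g.
Proof.
move=> /= /and3P[ha hb _] ab; rewrite !mulgA TpuV_Uvec ?ix_neq//.
congr (Uvec _ * _ * _)%g; apply/funext => i.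
rewrite nth_set_nth /= -val_eqE /= !ixE//.
by case: eqP => [->//|]; rewrite subr0.
Qed.

(** [T], [S] and [U] are kept abstract, so that simplification evaluates the lists of coefficients
    without unfolding group elements. *)
Lemma tetrahedron_collect (H : groupType) (T S : nat -> nat ->
  H) (U : seq R[i] -> H)
    (k l m n : R[i]) :
  (forall a b v x, all (fun n => 0 < n <= 6)%N [:: a; b] -> a != b ->
    T a b * (U v * x) = U (set_nth 0 v b.-1 (v`_b.-1 +
      v`_a.-1)%R) * (T a b * x))%g ->
  (forall a b v x, all (fun n => 0 < n <= 6)%N [:: a; b] -> a != b ->
    S a b * (U v * x) = U (set_nth 0 v b.-1 (v`_b.-1 - v`_a.-1)%R) *
      (S a b * x))%g ->
  (forall v w x, size v = 6 -> size w = 6 ->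
    U v * (U w * x) = U [seq (p.1 + p.2)%R | p <- zip v w] * x)%g ->
  (T 4%N 5%N * S 4%N 6%N * (T 2%N 3%N * S 2%N 5%N) * (T 1%N 5%N *
    S 1%N 6%N) * (T 1%N 2%N * S 1%N 4%N) =
   T 1%N 2%N * S 1%N 4%N * (T 1%N 3%N * S 1%N 5%N) * (T 4%N 5%N *
     S 4%N 6%N) * (T 2%N 3%N * S 2%N 5%N))%g ->
  m = n + k ->
  let P a b c (x : R[i]) := (T a b * (S a c *
    U (mkseq (fun n => (if n.+1 == b then x else 0) - (if n.+1 == a then x else
      0))%R 6)))%g in
  (P 4%N 5%N 6%N k * P 2%N 3%N 5%N m * P 1%N 5%N 6%N n * P 1%N 2%N 4%N l =
   P 1%N 2%N 4%N l * P 1%N 3%N 5%N n * P 4%N 5%N 6%N m * P 2%N 3%N 5%N k)%g.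
Proof.
(* The extra trailing 1 gives every [U] a right neighbour, as the collecting rules require. *)
move=> hT hS hU tetra -> P; apply: (mulIg 1%g); rewrite /P -!mulgA /mkseq /=.
do ?[rewrite hT//= | rewrite hS//= | rewrite hU//=].
rewrite !mulg1.
rewrite -!mulgA in tetra; rewrite tetra.
congr (U _ * _)%g.
congr [:: _; _; _; _; _; _]; ring.
Qed.

(** The indices are those left after all transpositions have moved right; for instance rho_56 turns
    236 into 235. In the application k = lambda_56, n = lambda_35 and m = lambda_36. *)
Lemma Pn_tetrahedron (k l m n : R[i]) : m = n + k ->
  (Pl 4 5 6 k * Pl 2 3 5 m * Pl 1 5 6 n * Pl 1 2 4 l =
   Pl 1 2 4 l * Pl 1 3 5 n * Pl 4 5 6 m * Pl 2 3 5 k)%g.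
Proof.
move=> mE; rewrite !Pn_Useq//.
apply: (@tetrahedron_collect G (fun a b => t a b) (fun a b =>
  (t a b)^-1)%g Useq) => //.
- exact: Tpu_UseqA.
- exact: TpuV_UseqA.
- exact: Useq_mulA.
- exact: Tpu_tetrahedron.
Qed.

Lemma tperm_ix a b c : all (fun n => 0 < n <= 6)%N [:: a; b; c] ->
  tperm (ix a) (ix b) (ix c) =
    ix (if c == a then b else if c == b then a else c).
Proof.
move=> /= /and4P[ha hb hc _]; case: eqP => [->|/eqP ca]; first exact: tpermL.
case: eqP => [->|/eqP cb]; first exact: tpermR.
by rewrite tpermD ?ix_neq// eq_sym.
Qed.

Lemma Pop_tetrahedron (lam : 'I_6 -> R[i]) :
  (Pop lam 4 5 6 * Pop lam 2 3 6 * Pop lam 1 3 5 * Pop lam 1 2 4 =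
   Pop lam 1 2 4 * Pop lam 1 3 5 * Pop lam 2 3 6 * Pop lam 4 5 6)%g.
Proof.
rewrite !PopE ?ix_neq// !mulNSE !permN_Pn; congr (_, _).
  rewrite !permM /= !tperm_ix//=; apply: Pn_tetrahedron; ring.
apply/permP => x; have -> : x = ix x.+1 by apply: val_inj;
  rewrite /= ixE//= ltn_ord.
by case: x => [[|[|[|[|[|[|//]]]]]] hx]; rewrite /= !permM !tperm_ix.
Qed.

End Tetrahedron.

(** * The adjoint action on the dilogarithms *)

Definition swap_seq a b (v : seq int) : seq int :=
  mkseq (fun n => v`_(if n.+1 == a then b.-1 else if n.+1 == b then a.-1 else
    n)) 6.

Section Adjoint.
Variable R : realType.
Implicit Types (v w : linform R) (g : NS6 R).
Local Open Scope quotient_scope.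

Lemma ad_lieD (X : liealg R) v w : ad_lie X (v + w) = ad_lie X v + ad_lie X w.
Proof.
case: v w => [[p u] c] [[p' u'] c']; rewrite /ad_lie /=.
congr ((_, _), _).
- by rewrite mulmxDl opprD addrACA.
- by rewrite mulmxDl addrACA.
- by rewrite /mxC map_mxD linearD /= mulmxDr mxE opprD addrACA.
Qed.

Lemma ad_lie_cst (X : liealg R) (c : R[i]) : ad_lie X (Defs.cst c) = Defs.cst c.
Proof.
rewrite /ad_lie /= !mul0mx subrr addr0 /mxC map_mx0 trmx0 mulmx0 mxE subr0.
by [].
Qed.

Lemma AdD g v w : Ad g (v + w) = Ad g v + Ad g w.
Proof.
rewrite /Ad; have -> : ad_perm g.2 (v + w) = ad_perm g.2 v + ad_perm g.2 w.
  by rewrite /ad_perm /= !mulmxDl.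
move: (ad_perm _ v) (ad_perm _ w); elim: (generic_quotient.repr g.1) =>
  //= -[x|b hb] s IH v' w' /=.
  by rewrite IH ad_lieD.
by rewrite IH.
Qed.

Lemma Ad_cst g (c : R[i]) : Ad g (Defs.cst c) = Defs.cst c.
Proof.
rewrite /Ad; have -> : ad_perm g.2 (Defs.cst c) = Defs.cst c.
  by rewrite /ad_perm /= !mul0mx.
elim: (generic_quotient.repr g.1) => //= -[x|b hb] s IH /=; rewrite IH//.
exact: ad_lie_cst.
Qed.

Lemma AdMn g v n : Ad g (v *+ n) = Ad g v *+ n.
Proof.
elim: n => [|n IH]; first exact: (Ad_cst g 0).
by rewrite !mulrS AdD IH.
Qed.

Lemma Ad_fst_snd g v : Ad g v = Ad g (v.1, 0) + Defs.cst v.2.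
Proof.
rewrite -[in RHS](Ad_cst g) -AdD; congr Ad.
by case: v => m c; rewrite -[RHS]/(m + 0, 0 + c) addr0 add0r.
Qed.

Lemma Ad_fst_inj g : injective (fun m : expo => (Ad g (m, 0)).1).
Proof.
move=> m n /= mn.
have e (k : expo) : (Ad g^-1%g ((Ad g (k, 0)).1, 0)).1 = k.
  have := congr1 fst (Ad_fst_snd g^-1%g (Ad g (k, 0))).
  by rewrite -AdM mulVg Ad1 /= addr0.
by rewrite -[m]e mn e.
Qed.

Lemma fAdE g (F : fser R) : fAd g F =
  push (fun m => (Ad g (m, 0)).1) (fun m => F m * Cexp (Ad g (m, 0)).2).
Proof.
apply/funext => m; rewrite /fAd /push [RHS]fsbig_mkcond.
apply: eq_fsbigr => n _; rewrite /fexp /patch.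
case: eqP => [->|mv]; case: ifPn => //.
- by rewrite notin_setE => /(_ erefl).
- by rewrite inE /= => /esym.
- by rewrite mulr0.
Qed.

(** [Ad g] is additive, so it sends the ray of multiples of v to that of [Ad g v]. A nonzero
    exponent makes this ray injective, hence its fibres finite. *)
Lemma fAd_qdilog hbar g v : v.1 != 0 ->
  fAd g (qdilog hbar (fexp v)) = qdilog hbar (fexp (Ad g v)).
Proof.
move=> v0; rewrite fAdE !qdilogE push_mulr push_comp; last first.
  apply: ffib_comp (@Ad_fst_inj g); exact/ffib_inj/expo_mulrn_inj.
have e n : Ad g (v *+ n) = Ad g (v.1 *+ n, 0) + Defs.cst (v.2 *+ n).
  by rewrite Ad_fst_snd linform_fstMn linform_sndMn.
apply: eq_push => n /=.
  by rewrite -[RHS]linform_fstMn -AdMn e /= addr0.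
by rewrite -(linform_sndMn (Ad g v)) -AdMn e /= CexpD; ring.
Qed.

Definition lform (p u : seq int) (c : R[i]) : linform R :=
  (((\row_j p`_j, \row_j u`_j) : expo), c).

Lemma Ad_wordE (x : word R) (s : 'S_6) v : Ad ((\pi_(NA3 R) x,
  s) : NS6 R) v = ad_word x (ad_perm s v).
Proof. by apply: ad_bch; exact: NA3_repr. Qed.

Lemma delta_lform_r (p : seq int) (a b : 'I_6) :
  (\row_(j < 6) p`_j) *m delta_mx a b = \row_j (if j == b then p`_a else 0).
Proof.
apply/rowP => j; rewrite !mxE (bigD1 a)//= big1 => [|i ia]; rewrite !mxE.
  by rewrite eqxx /= addr0; case: eqP => _; rewrite ?mulr1 ?mulr0.
by rewrite (negPf ia) mulr0.
Qed.

Local Notation in6 := (fun n => 0 < n <= 6)%N.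

Lemma ad_puw a b (s : bool) p u c : all in6 [:: a; b] -> a != b ->
  ad_word (puw R (ix a) (ix b) s) (lform p u c) =
  lform (set_nth 0 p a.-1 (p`_a.-1 - (-1) ^+ s * p`_b.-1))
        (set_nth 0 u b.-1 (u`_b.-1 + (-1) ^+ s * u`_a.-1)) c.
Proof.
move=> /= /and3P[ha hb _] ab; rewrite (puwE _ _ (ix_neq ha hb ab)) /=.
rewrite /ad_lie /= linearZ /= trmx_delta mul0mx mxE subr0.
rewrite -!scalemxAr !delta_lform_r; congr ((_, _), _).
  apply/rowP => j; rewrite !mxE nth_set_nth /= -val_eqE /= !ixE//.
  by case: eqP => [->//|_]; rewrite mulr0 subr0.
apply/rowP => j; rewrite !mxE nth_set_nth /= -val_eqE /= !ixE//.
by case: eqP => [->//|_]; rewrite mulr0 addr0.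
Qed.

Lemma ad_GU a (k : R[i]) p u c : in6 a ->
  ad_word [:: EXP (GU (ix a) k)] (lform p u c) =
    lform p u (c - k * (p`_a.-1)%:~R).
Proof.
move=> ha; rewrite /= /ad_lie /= trmx0 !mulmx0 subr0 addr0; congr (_, _ - _).
rewrite -scalemxAl mxE; congr (_ * _).
rewrite mxE (bigD1 (ix a))//= big1 => [|i ia]; rewrite !mxE ?eqxx /=.
  by rewrite mul1r addr0 ixE.
by rewrite (negPf ia) mul0r.
Qed.

Lemma ad_tperm a b p u c : all in6 [:: a; b] ->
  ad_perm (tperm (ix a) (ix b)) (lform p u c) =
  lform (swap_seq a b p) (swap_seq a b u) c.
Proof.
move=> /= /and3P[ha hb _].
have e (v : seq int) : (\row_(j < 6) v`_j) *m perm_mx (tperm (ix a) (ix b)) =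
   \row_j (swap_seq a b v)`_j.
  rewrite -[tperm _ _]invgK -col_permE tpermV; apply/rowP => j;
    rewrite !mxE nth_mkseq//.
  have jE : j = ix j.+1 by apply: val_inj; rewrite /= ixE//= ltn_ord.
  rewrite {1}jE tperm_ix/= ?ha ?hb ?ltn_ord//.
  by case: eqP => _; [|case: eqP => _]; rewrite ixE//= ltn_ord.
by rewrite /ad_perm /lform /= !e.
Qed.

End Adjoint.

(** * Coordinates for the arguments of the dilogarithms *)

Section Arguments.
Variables (R : realType) (hbar : R[i]) (lam : 'I_6 -> R[i]).
Local Notation q := (Cexp hbar).
Local Notation in6 := (fun n => 0 < n <= 6)%N.
Local Notation l n := (lam (ix n%N)).
Local Open Scope quotient_scope.

(* Action of Ad(P_abc) on the coefficients of the p_i, resp. u_i. *)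
Definition Pop_p a b c (p : seq int) : seq int :=
  let p1 := swap_seq b c p in
  let p2 := set_nth 0 p1 a.-1 (p1`_a.-1 + p1`_c.-1) in
  set_nth 0 p2 a.-1 (p2`_a.-1 - p2`_b.-1).

Definition Pop_u a b c (u : seq int) : seq int :=
  let u1 := swap_seq b c u in
  let u2 := set_nth 0 u1 c.-1 (u1`_c.-1 - u1`_a.-1) in
  set_nth 0 u2 b.-1 (u2`_b.-1 + u2`_a.-1).

(** The results [p'], [u'] and [n] are separate variables tied by equations, so that on explicit
    lists the equations hold by [erefl]. *)
Lemma Ad_Pop a b c p u x p' u' n :
  all in6 [:: a; b; c] -> uniq [:: a; b; c] ->
  Pop_p a b c p = p' -> Pop_u a b c u = u' -> p`_a.-1 - p`_c.-1 = n ->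
  Ad (Pop lam a b c) (lform p u x) = lform p' u' (x + (l b - l c) * n%:~R).
Proof.
move=> /= /and4P[ha hb hc _]; rewrite !inE !negb_or -!andbA.
move=> /and4P[ab ac bc _] <- <- <-.
rewrite PopE ?ix_neq// /Pn TpuV !pi_cat Ad_wordE !ad_word_cat ad_tperm;
  last by rewrite /= hb hc.
rewrite /Tpu /Uu !(ad_bch _ (NA3_repr _)) !ad_GU// !ad_puw/= ?ha ?hb ?hc//.
rewrite !expr1 !expr0 !mulN1r !mul1r !opprK.
have pb : (swap_seq b c p)`_b.-1 = p`_c.-1.
  by case: b hb {ab bc} => // b hb; rewrite nth_mkseq//= eqxx.
have pa : (swap_seq b c p)`_a.-1 = p`_a.-1.
  case: a ha ab ac => // a ha ab ac.
  by rewrite nth_mkseq//= (negPf ab) (negPf ac).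
by congr (lform _ _ _); rewrite pa pb rmorphB /=; ring.
Qed.

Definition dlog_arg a b c : linform R :=
  pn R a + un R a + pn R c - un R c - pn R b + Defs.cst (l a - l c).

Lemma dlog_argE a b c p u : all in6 [:: a; b; c] ->
  mkseq (fun n => (n == a.-1)%:Z + (n == c.-1)%:Z - (n == b.-1)%:Z) 6 = p ->
  mkseq (fun n => (n == a.-1)%:Z - (n == c.-1)%:Z) 6 = u ->
  dlog_arg a b c = lform p u (l a - l c).
Proof.
move=> /= /and4P[ha hb hc _] <- <-; rewrite /dlog_arg !pn_fst// !un_fst//.
congr ((_, _), _) => /=.
- by apply/rowP => j; rewrite !mxE nth_mkseq//; ring.
- by apply/rowP => j; rewrite !mxE nth_mkseq//; ring.
- by rewrite !(subr0, addr0, add0r).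
Qed.

Definition ydelta (i : 'I_9) : yexpo := [ffun j => (j == i) : nat].

Lemma ydelta_neq0 i : ydelta i != 0.
Proof. by apply/eqP => /ffunP/(_ i); rewrite !ffunE eqxx. Qed.

Lemma yexpo_add_neq0 (j k : yexpo) : j != 0 -> j + k != 0.
Proof.
apply: contraNneq => /ffunP h; apply/eqP/ffunP => i; have := h i.
by rewrite !ffunE; case: (j i).
Qed.

Lemma yform_sum_delta i : yform_sum lam (ydelta i) = yform lam i.
Proof.
rewrite /yform_sum (bigD1 i)//= big1 => [|j ji];
  first by rewrite ffunE eqxx addr0.
by rewrite ffunE (negPf ji).
Qed.

Lemma yform_sumD j k :
  yform_sum lam (j + k) = yform_sum lam j + yform_sum lam k.
Proof.
by rewrite /yform_sum -big_split; apply: eq_bigr => i _; rewrite ffunE mulrnDr.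
Qed.

Lemma bform_delta (i j : 'I_9) : (i <= j)%N -> bform (ydelta i) (ydelta j) = 0.
Proof.
move=> ij; rewrite /bform big1// => a _; rewrite big1// => b ba.
rewrite !ffunE; case: eqP => [ai|_]; last by rewrite mul0n mulr0n.
by case: eqP => [bj|_]; [move: ba;
  rewrite ai bj ltnNge ij | rewrite muln0 mulr0n].
Qed.

Lemma yquad_delta i : yquad (ydelta i) = 0.
Proof. by apply: oppr_inj; rewrite -bform_diag bform_delta ?oppr0. Qed.

Lemma yexp_sum_delta i : yexp_sum (ydelta i) = yexp i.
Proof.
rewrite /yexp_sum (bigD1 i)//= big1 => [|j ji];
  first by rewrite ffunE eqxx addr0.
by rewrite ffunE (negPf ji).
Qed.

(** For Y_4 Y_7 and Y_7 Y_8 the value is 2, the even number that [qdilog_unit] asks for. *)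
Lemma yquad_delta2 (i j : 'I_9) : (i <= j)%N ->
  yquad (ydelta i + ydelta j) = b2 i j.
Proof.
move=> ij; have := yquadD (ydelta i) (ydelta j).
by rewrite !yquad_delta bform_delta// !yexp_sum_delta -b2_omega !addr0 mul0rn
  add0r.
Qed.

Lemma lform_neq0 p u c n : (n < 6)%N -> u`_n != 0 ->
  (lform p u c : linform R).1 != 0.
Proof.
move=> n6; apply: contraNneq => -[_ /rowP/(_ (Ordinal n6))].
by rewrite !mxE => ->.
Qed.

End Arguments.

(** * The six arguments and the identity between dilogarithms *)

Section Dilogarithms.
Variables (R : realType) (hbar : R[i]) (lam : 'I_6 -> R[i]).
Local Notation q := (Cexp hbar).
Local Notation l n := (lam (ix n%N)).
Local Notation y n := (ydelta (@Ordinal 9 n.-1 isT)).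
Local Notation Psi k := (qdilog hbar (fexp (yform_sum lam k))).
Local Notation P i j k := (Pop lam i%N j%N k%N).
Local Notation D i j k := (dlog_arg lam i%N j%N k%N).

Lemma lformD p p' u u' (c c' : R[i]) : size p = 6 -> size p' = 6 ->
  size u = 6 -> size u' = 6 ->
  lform p u c + lform p' u' c' =
  lform [seq s.1 + s.2 | s <- zip p p'] [seq s.1 + s.2 | s <- zip u u'] (c +
    c').
Proof.
move=> sp sp' su su'; congr ((_, _), _); apply/rowP => j; rewrite !mxE.
  by rewrite (nth_map (0, 0)) ?nth_zip//= ?size_zip ?sp ?sp'// minnn.
by rewrite (nth_map (0, 0)) ?nth_zip//= ?size_zip ?su ?su'// minnn.
Qed.

Lemma yform4 : yform_sum lam (y 4) = lform [:: 0; 1; -1; -1; 1; 0] [:: 0; 1; 0;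
  0; -1; 0] (l 2 - l 5).
Proof. by rewrite yform_sum_delta. Qed.

Lemma yform7 : yform_sum lam (y 7) = lform [:: 1; -1; 0; 1; 0; 0] [:: 1; 0; 0;
  -1; 0; 0] (l 1 - l 4).
Proof. by rewrite yform_sum_delta. Qed.

Lemma yform8 : yform_sum lam (y 8) = lform [:: 0; 0; 0; 1; -1; 1] [:: 0; 0; 0;
  1; 0; -1] (l 4 - l 6).
Proof. by rewrite yform_sum_delta. Qed.

Lemma yform47 : yform_sum lam (y 4 + y 7) =
  lform [:: 1; 0; -1; 0; 1; 0] [:: 1; 1; 0; -1; -1;
    0] (l 2 - l 5 + (l 1 - l 4)).
Proof. by rewrite yform_sumD yform4 yform7 lformD. Qed.

Lemma yform78 : yform_sum lam (y 7 + y 8) =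
  lform [:: 1; -1; 0; 2; -1; 1] [:: 1; 0; 0; 0; 0;
    -1] (l 1 - l 4 + (l 4 - l 6)).
Proof. by rewrite yform_sumD yform7 yform8 lformD. Qed.

Lemma dlog456E : D 4 5 6 = lform [:: 0; 0; 0; 1; -1; 1] [:: 0; 0; 0; 1; 0;
  -1] (l 4 - l 6).
Proof. exact: dlog_argE. Qed.

Lemma dlog124E : D 1 2 4 = lform [:: 1; -1; 0; 1; 0; 0] [:: 1; 0; 0; -1; 0;
  0] (l 1 - l 4).
Proof. exact: dlog_argE. Qed.

Lemma dlog236E : D 2 3 6 = lform [:: 0; 1; -1; 0; 0; 1] [:: 0; 1; 0; 0; 0;
  -1] (l 2 - l 6).
Proof. exact: dlog_argE. Qed.

Lemma dlog135E : D 1 3 5 = lform [:: 1; 0; -1; 0; 1; 0] [:: 1; 0; 0; 0; -1;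
  0] (l 1 - l 5).
Proof. exact: dlog_argE. Qed.

(** The parameters telescope: lambda_26 - lambda_56 = lambda_25, in agreement with the scalar in
    phi(Y_4). *)
Lemma Ad456_D236 : Ad (P 4 5 6)%g (D 2 3 6) = yform_sum lam (y 4).
Proof.
rewrite dlog236E.
rewrite (@Ad_Pop _ lam 4 5 6 [:: 0; 1; -1; 0; 0; 1] [:: 0; 1; 0; 0; 0; -1] _
  [:: 0; 1; -1; -1; 1; 0] [:: 0; 1; 0; 0; -1; 0] (-1)
  isT isT erefl erefl erefl).
by rewrite yform4; congr lform; rewrite ?rmorphN ?rmorph0 ?rmorph1; ring.
Qed.

(** The exponent reached after P_236 alone is not in the span of those of the phi(Y_i); applying
    P_456 brings it back. *)
Lemma Ad456_236_D135 : Ad (P 4 5 6 * P 2 3 6)%g (D 1 3 5) =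
  yform_sum lam (y 7 + y 8).
Proof.
rewrite AdM dlog135E.
rewrite (@Ad_Pop _ lam 2 3 6 [:: 1; 0; -1; 0; 1; 0] [:: 1; 0; 0; 0; -1; 0] _
  [:: 1; -1; 0; 0; 1; -1] [:: 1; 0; 0; 0; -1; 0] (0)
  isT isT erefl erefl erefl).
rewrite (@Ad_Pop _ lam 4 5 6 [:: 1; -1; 0; 0; 1; -1] [:: 1; 0; 0; 0; -1; 0] _
  [:: 1; -1; 0; 2; -1; 1] [:: 1; 0; 0; 0; 0; -1] (1)
  isT isT erefl erefl erefl).
by rewrite yform78; congr lform; rewrite ?rmorphN ?rmorph0 ?rmorph1; ring.
Qed.

Lemma Ad456_236_135_D124 : Ad (P 4 5 6 * P 2 3 6 * P 1 3 5)%g (D 1 2 4) =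
  yform_sum lam (y 7).
Proof.
rewrite 2!AdM dlog124E.
rewrite (@Ad_Pop _ lam 1 3 5 [:: 1; -1; 0; 1; 0; 0] [:: 1; 0; 0; -1; 0; 0] _
  [:: 1; -1; 0; 1; 0; 0] [:: 1; 0; 1; -1; -1; 0] (1)
  isT isT erefl erefl erefl).
rewrite (@Ad_Pop _ lam 2 3 6 [:: 1; -1; 0; 1; 0; 0] [:: 1; 0; 1; -1; -1; 0] _
  [:: 1; -1; 0; 1; 0; 0] [:: 1; 0; 0; -1; -1; 1] (-1)
  isT isT erefl erefl erefl).
rewrite (@Ad_Pop _ lam 4 5 6 [:: 1; -1; 0; 1; 0; 0] [:: 1; 0; 0; -1; -1; 1] _
  [:: 1; -1; 0; 1; 0; 0] [:: 1; 0; 0; -1; 0; 0] (1)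
  isT isT erefl erefl erefl).
by rewrite yform7; congr lform; rewrite ?rmorphN ?rmorph0 ?rmorph1; ring.
Qed.

Lemma Ad124_D135 : Ad (P 1 2 4)%g (D 1 3 5) = yform_sum lam (y 4 + y 7).
Proof.
rewrite dlog135E.
rewrite (@Ad_Pop _ lam 1 2 4 [:: 1; 0; -1; 0; 1; 0] [:: 1; 0; 0; 0; -1; 0] _
  [:: 1; 0; -1; 0; 1; 0] [:: 1; 1; 0; -1; -1; 0] (1)
  isT isT erefl erefl erefl).
by rewrite yform47; congr lform; rewrite ?rmorphN ?rmorph0 ?rmorph1; ring.
Qed.

Lemma Ad124_135_D236 : Ad (P 1 2 4 * P 1 3 5)%g (D 2 3 6) = yform_sum lam (y 8).
Proof.
rewrite AdM dlog236E.
rewrite (@Ad_Pop _ lam 1 3 5 [:: 0; 1; -1; 0; 0; 1] [:: 0; 1; 0; 0; 0; -1] _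
  [:: -1; 1; 0; 0; -1; 1] [:: 0; 1; 0; 0; 0; -1] (0)
  isT isT erefl erefl erefl).
rewrite (@Ad_Pop _ lam 1 2 4 [:: -1; 1; 0; 0; -1; 1] [:: 0; 1; 0; 0; 0; -1] _
  [:: 0; 0; 0; 1; -1; 1] [:: 0; 0; 0; 1; 0; -1] (-1)
  isT isT erefl erefl erefl).
by rewrite yform8; congr lform; rewrite ?rmorphN ?rmorph0 ?rmorph1; ring.
Qed.

Lemma Ad124_135_236_D456 : Ad (P 1 2 4 * P 1 3 5 * P 2 3 6)%g (D 4 5 6) =
  yform_sum lam (y 4).
Proof.
rewrite 2!AdM dlog456E.
rewrite (@Ad_Pop _ lam 2 3 6 [:: 0; 0; 0; 1; -1; 1] [:: 0; 0; 0; 1; 0; -1] _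
  [:: 0; -1; 1; 1; -1; 0] [:: 0; 0; -1; 1; 0; 0] (-1)
  isT isT erefl erefl erefl).
rewrite (@Ad_Pop _ lam 1 3 5 [:: 0; -1; 1; 1; -1; 0] [:: 0; 0; -1; 1; 0; 0] _
  [:: 2; -1; -1; 1; 1; 0] [:: 0; 0; 0; 1; -1; 0] (1)
  isT isT erefl erefl erefl).
rewrite (@Ad_Pop _ lam 1 2 4 [:: 2; -1; -1; 1; 1; 0] [:: 0; 0; 0; 1; -1; 0] _
  [:: 0; 1; -1; -1; 1; 0] [:: 0; 1; 0; 0; -1; 0] (1)
  isT isT erefl erefl erefl).
by rewrite yform4; congr lform; rewrite ?rmorphN ?rmorph0 ?rmorph1; ring.
Qed.

Lemma dlog_arg_neq0 :
  [/\ (D 4 5 6).1 != 0, (D 2 3 6).1 != 0, (D 1 3 5).1 != 0 & (D 1 2 4).1 != 0].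
Proof.
rewrite dlog456E dlog236E dlog135E dlog124E; split.
- exact: (@lform_neq0 _ _ _ _ 3).
- exact: (@lform_neq0 _ _ _ _ 1).
- exact: (@lform_neq0 _ _ _ _ 0).
- exact: (@lform_neq0 _ _ _ _ 0).
Qed.

Lemma omega_y (i j : 'I_9) : omega (yform_sum lam (ydelta i)).1 (yform_sum lam
  (ydelta j)).1 = b2 i j.
Proof. by rewrite !yform_sum_delta b2_omega. Qed.

Lemma Psi_comm j k : j != 0 -> k != 0 ->
  omega (yform_sum lam j).1 (yform_sum lam k).1 = 0 ->
  fmul hbar (Psi j) (Psi k) = fmul hbar (Psi k) (Psi j).
Proof.
have ray (i : yexpo) : i != 0 -> ffib (fun n => i *+ n) by move=> i0;
  exact/ffib_inj/yexpo_mulrn_inj.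
have yray i : i != 0 -> ffib (fun n => (yform_sum lam i).1 *+ n).
  move=> i0; rewrite yform_sum_fst
    (_ : (fun n => _) = yexp_sum \o (fun n => i *+ n)).
    exact: ffib_comp (ray i i0) yexp_sum_inj.
  by apply/funext => n; rewrite /= yexp_sum_mulrn.
move=> j0 k0; apply: qdilog_comm; [exact: yray | exact: yray |].
rewrite !yform_sum_fst (_ : (fun n => _) = yexp_sum \o (fun n : nat * nat =>
  j *+ n.1 + k *+ n.2)).
  exact: ffib_comp (ffib_add (ray j j0) (ray k k0)) yexp_sum_inj.
by apply/funext => n; rewrite /= yexp_sumD !yexp_sum_mulrn.
Qed.

Hypothesis q1 : forall n, (0 < n)%N -> q ^+ n != 1.

Lemma Psi_unit i : What_unit hbar lam (Psi (ydelta i)).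
Proof. by apply: (qdilog_unit _ q1 (w := 0));
  [exact: ydelta_neq0 | rewrite yquad_delta]. Qed.

Lemma Psi_unit2 (i j : 'I_9) : (i <= j)%N -> b2 i j = 2 ->
  What_unit hbar lam (Psi (ydelta i + ydelta j)).
Proof.
move=> ij bij; apply: (qdilog_unit _ q1 (w := 1)).
  exact/yexpo_add_neq0/ydelta_neq0.
by rewrite yquad_delta2.
Qed.

Local Notation op := (fmul hbar).

Lemma Psi_tetrahedron :
  op (op (op (Psi (y 8)) (Psi (y 4))) (Psi (y 7 + y 8))) (Psi (y 7)) =
  op (op (op (Psi (y 7)) (Psi (y 4 + y 7))) (Psi (y 8))) (Psi (y 4)).
Proof.
have u4 := Psi_unit (@Ordinal 9 3 isT); have u7 := Psi_unit (@Ordinal 9 6 isT).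
have u8 := Psi_unit (@Ordinal 9 7 isT).
have u47 : What_unit hbar lam (Psi (y 4 + y 7)) by apply: Psi_unit2.
have u78 : What_unit hbar lam (Psi (y 7 + y 8)) by apply: Psi_unit2.
have M := @What_unit_fmul R hbar lam; have A := @What_fmulA R hbar lam.
have p78 : op (Psi (y 7)) (Psi (y 8)) = op (op (Psi (y 8)) (Psi (y 7 +
  y 8))) (Psi (y 7)).
  by rewrite yform_sumD; apply: pentagon; rewrite // omega_y.
have p47 : op (Psi (y 4)) (Psi (y 7)) = op (op (Psi (y 7)) (Psi (y 4 +
  y 7))) (Psi (y 4)).
  by rewrite yform_sumD; apply: pentagon; rewrite // omega_y.
have c1 : op (Psi (y 4)) (Psi (y 7 + y 8)) = op (Psi (y 7 + y 8)) (Psi (y 4)).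
  apply: Psi_comm; do ?apply: yexpo_add_neq0; do ?exact: ydelta_neq0.
  by rewrite yform_sumD omegaDr !omega_y.
have c2 : op (Psi (y 8)) (Psi (y 4 + y 7)) = op (Psi (y 4 + y 7)) (Psi (y 8)).
  apply: Psi_comm; do ?apply: yexpo_add_neq0; do ?exact: ydelta_neq0.
  by rewrite yform_sumD omegaDr !omega_y.
move: (Psi (y 8)) (Psi (y 4)) (Psi (y 7 + y 8)) (Psi (y 7)) (Psi (y 4 + y 7))
  u8 u4 u78 u7 u47 p78 p47 c1 c2 => a b c d e ua ub uc ud ue ac bd bc ae.
(* The chain, up to associativity: abcd = acbd = acdeb = daeb = deab. *)
have uac := M _ _ ua uc; have ude := M _ _ ud ue.
rewrite -(A a b c)// bc (A a c b)// -(A _ b d)// bd (A _ _ b)//.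
by rewrite (A _ d e)// -ac -(A d a e)// ae (A d e a).
Qed.

End Dilogarithms.

(** * The tetrahedron equation for R_ijk *)

Lemma sdmul4 (R : realType) (hbar : R[i]) (lam : 'I_6 -> R[i])
    (x1 x2 x3 x4 : sdp R) (F1 F2 F3 F4 : fser R) :
  x1.1 = F1 -> fAd x1.2 x2.1 = F2 -> fAd (x1.2 * x2.2)%g x3.1 = F3 ->
  fAd (x1.2 * x2.2 * x3.2)%g x4.1 = F4 ->
  What_unit hbar lam F1 -> What_unit hbar lam F2 ->
  What_unit hbar lam F3 -> What_unit hbar lam F4 ->
  sddefined hbar lam x1 [:: x2; x3; x4] /\
  sdmul hbar (sdmul hbar (sdmul hbar x1 x2) x3) x4 =
    (fmul hbar (fmul hbar (fmul hbar F1 F2) F3) F4,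
      (x1.2 * x2.2 * x3.2 * x4.2)%g).
Proof.
move: x1 x2 x3 x4 => [G1 g1] [G2 g2] [G3 g3] [G4 g4] /= -> e2 e3 e4 u1 u2 u3 u4.
rewrite /sdmul /= e2 e3 e4; split => //.
by do 3! (split => //; do ?apply: What_unit_fmul => //).
Qed.

Theorem theorem4p6 (R : realType) (hbar : R[i]) (lam : 'I_6 -> R[i]) :
  let P456 := Pop lam 4 5 6 in let P236 := Pop lam 2 3 6 in
  let P135 := Pop lam 1 3 5 in let P124 := Pop lam 1 2 4 in
  let R456 := Rop hbar lam 4 5 6 in let R236 := Rop hbar lam 2 3 6 in
  let R135 := Rop hbar lam 1 3 5 in let R124 := Rop hbar lam 1 2 4 in
  let mul := sdmul hbar in
  (P456 * P236 * P135 * P124 = P124 * P135 * P236 * P456)%g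
  /\
  ((forall n : nat, (0 < n)%N -> Cexp hbar ^+ n != 1) ->
   [/\ sddefined hbar lam R456 [:: R236; R135; R124],
       sddefined hbar lam R124 [:: R135; R236; R456]
     & mul (mul (mul R456 R236) R135) R124
       = mul (mul (mul R124 R135) R236) R456]).
Proof.
move=> P456 P236 P135 P124 R456 R236 R135 R124 mul.
split; first exact: Pop_tetrahedron.
move=> q1; have [n456 n236 n135 n124] := dlog_arg_neq0 lam.
(* The [A] facts give the second to fourth dilogarithms of the left-hand product after the P's to
   their left have acted; the [B] facts do the same for the right-hand product. *)
have A236 := fAd_qdilog hbar P456 n236; rewrite Ad456_D236 in A236.
have A135 := fAd_qdilog hbar (P456 * P236)%g n135;
  rewrite Ad456_236_D135 in A135.
have A124 := fAd_qdilog hbar (P456 * P236 * P135)%g n124;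
  rewrite Ad456_236_135_D124 in A124.
have B135 := fAd_qdilog hbar P124 n135; rewrite Ad124_D135 in B135.
have B236 := fAd_qdilog hbar (P124 * P135)%g n236;
  rewrite Ad124_135_D236 in B236.
have B456 := fAd_qdilog hbar (P124 * P135 * P236)%g n456;
  rewrite Ad124_135_236_D456 in B456.
have u := Psi_unit lam q1.
have u47 := Psi_unit2 lam q1 (i := @Ordinal 9 3 isT) (j := @Ordinal 9 6 isT)
  isT erefl.
have u78 := Psi_unit2 lam q1 (i := @Ordinal 9 6 isT) (j := @Ordinal 9 7 isT)
  isT erefl.
have E456 : R456.1 = qdilog hbar (fexp (yform_sum lam (ydelta (@Ordinal 9 7
  isT)))).
  by rewrite yform8 -dlog456E.
have E124 : R124.1 = qdilog hbar (fexp (yform_sum lam (ydelta (@Ordinal 9 6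
  isT)))).
  by rewrite yform7 -dlog124E.
have [d1 m1] := sdmul4 (x2 := R236) (x3 := R135) (x4 := R124)
  E456 A236 A135 A124 (u _) (u _) u78 (u _).
have [d2 m2] := sdmul4 (x2 := R135) (x3 := R236) (x4 := R456)
  E124 B135 B236 B456 (u _) u47 (u _) (u _).
split => //; rewrite /mul m1 m2; congr pair; first exact: Psi_tetrahedron.
exact: Pop_tetrahedron.
Qed.
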